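(* Consider the Abel equation $\frac{dx}{dt}=(a_0+a_1t^j+a_2t^k)x^3+(b_0+b_1t^j+b_2t^k)x^2$ with $j,k\in\mathbb{N}$, $0<j<k$, and $a_0,a_1,a_2,b_0,b_1,b_2$ arbitrary real numbers. (a) It has a center at $x=0$ if and only if $a_0+a_1/(j+1)+a_2/(k+1)=b_0+b_1/(j+1)+b_2/(k+1)=a_2b_1-a_1b_2=0$. (b) Suppose it does not have a center at $x=0$, and consider the following three conditions: 1) either $a_2b_1-a_1b_2=0$ or $\frac{a_2b_0-a_0b_2}{a_2b_1-a_1b_2}\notin(-1,0)$; 2) either $a_1b_2-a_2b_1=0$ or $\frac{a_1b_0-a_0b_1}{a_1b_2-a_2b_1}\notin(-1,0)$; 3) either $a_0b_2-a_2b_0=0$ or $\frac{a_0b_1-a_1b_0}{a_0b_2-a_2b_0}\notin(-1,0)$. If one of these three conditions is satisfied, then the equation has at most one non-zero periodic orbit, and when this periodic orbit exists, it is hyperbolic. (c) There are equations of this form having at least two non-zero hyperbolic periodic orbits.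
   Context: A periodic orbit of an equation $dx/dt=A(t)x^3+B(t)x^2$ on the strip $\{(t,x): t\in[0,1], x\in\mathbb{R}\}$ is a solution with $x(0)=x(1)$; $x=0$ is always one. A periodic orbit is hyperbolic if the Poincaré map between $t=0$ and $t=1$ has derivative different from 1 at its initial condition. The equation has a center at a periodic orbit if all orbits in a neighborhood of it are periodic. *)

(* Defs.v *)
From Stdlib Require Import Reals Lra ClassicalEpsilon.
From Coquelicot Require Import Coquelicot.
Open Scope R_scope.

(* x is a solution on [0,1]: at every t in [0,1], x is differentiable with
   derivative A t * x t ^ 3 + B t * x t ^ 2.  (Two-sided derivative at the
   endpoints; any solution on the closed interval extends slightly beyond
   since the right-hand side is defined for all t.) *)
Definition is_sol (A B : R -> R) (x : R -> R) : Prop :=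
  forall t, 0 <= t <= 1 -> is_derive x t (A t * x t ^ 3 + B t * x t ^ 2).

Definition poincare_rel (A B : R -> R) (x0 y : R) : Prop :=
  exists x, is_sol A B x /\ x 0 = x0 /\ x 1 = y.

(* Poincaré map as a function (its value is meaningful on its domain,
   where the solution exists on [0,1]; it is unique there). *)
Definition poincare (A B : R -> R) (x0 : R) : R :=
  epsilon (inhabits 0) (fun y => poincare_rel A B x0 y).

Definition periodic_orbit (A B : R -> R) (x0 : R) : Prop :=
  poincare_rel A B x0 x0.

Definition hyperbolic (A B : R -> R) (x0 : R) : Prop :=
  periodic_orbit A B x0 /\
  ex_derive (poincare A B) x0 /\ Derive (poincare A B) x0 <> 1.

Definition has_center_at_0 (A B : R -> R) : Prop :=
  exists delta, 0 < delta /\ forall x0, Rabs x0 < delta -> periodic_orbit A B x0.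

Definition trinom (c0 c1 c2 : R) (j k : nat) (t : R) : R :=
  c0 + c1 * t ^ j + c2 * t ^ k.

Definition cond_ratio (n d : R) : Prop :=
  d = 0 \/ ~ (-1 < n / d < 0).

(* Main.v *)
Require Import Defs.
From Stdlib Require Import Reals.
From Coquelicot Require Import Coquelicot.
From Stdlib Require Import Lra Lia ClassicalEpsilon FunctionalExtensionality.
Open Scope R_scope.

(* Write [A], [B] for the coefficients and [IA], [IB] for their primitives vanishing at 0.

   (a) Along a small periodic solution, [W = 1/x + IB] satisfies [W' = - A x].  Comparing [W],
   [W^2/2 + IA] and [W^3/3 + W IA + int (A IB)] at both ends of [0,1] gives successively
   [int B = 0], [int A = 0] and [int (A IB) = 0]; for trinomials the last integral is a nonzero
   multiple of [a2 b1 - a1 b2].  Conversely [A] and [B] are then multiples of one [P] of mean 0,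
   and every small solution is an autonomous solution composed with the primitive of [P].

   (b) Each condition yields a combination [C = a A + b B] of constant sign on (0,1).  Periodic
   solutions avoid the line [x = a / b].  If [F' = 1 / (x^2 (a - b x))], then for periodic x, y
   the derivative of [F(x) - F(y)] is [C (x - y) / ((a - b x) (a - b y))], and Rolle's theorem
   excludes [x <> y].  The logarithm of the multiplier is [int A x^2], and
   [A x^2 - (ln |a - b x|)' = C x^2 / (a - b x)], so Rolle's theorem gives hyperbolicity.

   (c) For [A = t - 1/2] and [B = t^2 - t + c], the map [x(t) -> - x(1 - t)] preserves solutions,
   so one nonzero periodic orbit gives a second one.  It exists for some [c] in [0,1/4]: for the
   solution with [x(1/2) = 1/2], [x(1) - x(0)] is negative at [c = 0] and positive at [c = 1/4]. *)

(** * Real analysis on the unit interval *)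

(* [auto_derive] leaves derivatives of abstract functions eta-expanded. *)
Ltac rewrite_derive H :=
  let E := fresh in
  pose proof (is_derive_unique _ _ _ H) as E;
  match type of E with Derive ?f ?x = ?l => change (Derive (fun u => f u) x = l) in E end;
  rewrite ?E; clear E.

Definition clamp (a b x : R) : R := Rmax a (Rmin b x).

Lemma clamp_bounds (a b x : R) : a <= b -> a <= clamp a b x <= b.
Proof. intros H; unfold clamp, Rmax, Rmin; repeat destruct Rle_dec; lra. Qed.

Lemma clamp_id (a b x : R) : a <= x <= b -> clamp a b x = x.
Proof. intros H; unfold clamp, Rmax, Rmin; repeat destruct Rle_dec; lra. Qed.

Lemma clamp_lipschitz (a b x y : R) :
  Rabs (clamp a b x - clamp a b y) <= Rabs (x - y).
Proof.
  unfold clamp, Rmax, Rmin; repeat destruct Rle_dec; split_Rabs; lra.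
Qed.

Lemma continuous_lipschitz (f : R -> R) (L x : R) :
  (forall y, Rabs (f y - f x) <= L * Rabs (y - x)) -> continuous f x.
Proof.
  intros H.
  assert (HL : 0 < Rabs L + 1) by (pose proof (Rabs_pos L); lra).
  apply filterlim_locally; intros eps.
  assert (He : 0 < eps / (Rabs L + 1)) by (apply Rdiv_lt_0_compat; [apply cond_pos | lra]).
  exists (mkposreal _ He); intros y Hy.
  change (Rabs (y - x) < eps / (Rabs L + 1)) in Hy.
  change (Rabs (f y - f x) < eps).
  apply Rmult_lt_compat_r with (r := Rabs L + 1) in Hy; [|lra].
  unfold Rdiv in Hy; rewrite Rmult_assoc, Rinv_l in Hy by lra.
  specialize (H y); pose proof (Rle_abs L); pose proof (Rabs_pos (y - x)).
  nra.
Qed.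

Lemma clamp_continuous (a b x : R) : continuous (clamp a b) x.
Proof.
  apply continuous_lipschitz with 1; intros y; rewrite Rmult_1_l; apply clamp_lipschitz.
Qed.

Lemma is_derive_continuous (f : R -> R) (x l : R) : is_derive f x l -> continuous f x.
Proof. intros H; exact (ex_derive_continuous f x (ex_intro _ l H)). Qed.

Lemma mvt (f df : R -> R) (a b : R) :
  a < b -> (forall t, a <= t <= b -> is_derive f t (df t)) ->
  exists c, a < c < b /\ f b - f a = df c * (b - a).
Proof.
  intros Hab H.
  destruct (MVT_cor2 f df a b Hab) as [c [H1 H2]].
  - intros c Hc; apply is_derive_Reals, H, Hc.
  - exists c; split; assumption.
Qed.

Lemma rolle (f df : R -> R) (a b : R) :
  a < b -> (forall t, a <= t <= b -> is_derive f t (df t)) -> f a = f b ->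
  exists c, a < c < b /\ df c = 0.
Proof.
  intros Hab H E.
  destruct (mvt f df a b Hab H) as [c [Hc E']].
  exists c; split; [assumption|].
  assert (df c * (b - a) = 0) by lra.
  destruct (Rmult_integral _ _ H0); lra.
Qed.

Lemma bounded_on (f : R -> R) (a b : R) :
  (forall t, a <= t <= b -> continuous f t) ->
  exists M, 0 < M /\ forall t, a <= t <= b -> Rabs (f t) <= M.
Proof.
  intros H.
  destruct (bounded_continuity f a b) as [M HM].
  { intros t Ht; now apply H. }
  exists (Rabs M + 1); split; [pose proof (Rabs_pos M); lra|].
  intros t Ht; specialize (HM t Ht); change (Rabs (f t) < M) in HM.
  pose proof (Rle_abs M); lra.
Qed.

Lemma is_derive_RInt_continuous (f : R -> R) (a t : R) :
  (forall s, continuous f s) -> is_derive (RInt f a) t (f t).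
Proof.
  intros H; apply (is_derive_RInt f (RInt f a) a t); [|apply H].
  apply filter_forall; intros s.
  apply (RInt_correct (V := R_CompleteNormedModule)), (ex_RInt_continuous (V := R_CompleteNormedModule)).
  intros z _; apply H.
Qed.

(** Freezing [f] outside [0,1] gives an integrand continuous on the whole line, so its integral has
    a two-sided derivative even at 0 and 1. *)
Lemma primitive_unit (f : R -> R) :
  (forall t, 0 <= t <= 1 -> continuous f t) ->
  exists I : R -> R, forall t, 0 <= t <= 1 -> is_derive I t (f t).
Proof.
  intros H.
  set (g := fun s => f (clamp 0 1 s)).
  assert (Hg : forall s, continuous g s).
  { intros s; apply (continuous_comp (clamp 0 1) f); [apply clamp_continuous|].
    apply H, clamp_bounds; lra. }
  exists (RInt g 0); intros t Ht.
  replace (f t) with (g t) by (unfold g; rewrite clamp_id; [reflexivity | lra]).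
  now apply is_derive_RInt_continuous.
Qed.

(** The bound on [dN] makes [N u * exp (- L * u)] nonincreasing and [N u * exp (L * u)]
    nondecreasing; the first settles [s < t], the second [t < s]. The sign [sg] treats both at
    once. *)
Lemma gronwall_two_sided (N dN : R -> R) (L s t : R) :
  (forall u, Rmin s t <= u <= Rmax s t -> is_derive N u (dN u)) ->
  (forall u, Rmin s t <= u <= Rmax s t -> Rabs (dN u) <= L * N u) ->
  N t <= N s * exp (L * Rabs (t - s)).
Proof.
  intros HN HL.
  assert (pos : forall u v, Rmin s t <= u <= Rmax s t -> Rmin s t <= v <= Rmax s t ->
            u < v -> forall sg, sg = 1 \/ sg = -1 ->
            sg * N v * exp (- sg * L * v) <= sg * N u * exp (- sg * L * u)).
  { intros u v Hu Hv Huv sg Hsg.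
    destruct (mvt (fun w => sg * N w * exp (- sg * L * w))
       (fun w => sg * (dN w - sg * L * N w) * exp (- sg * L * w)) u v Huv) as [c [Hc E]].
    - intros w Hw.
      assert (D : is_derive N w (dN w)) by (apply HN; lra).
      auto_derive; [now exists (dN w)|]. rewrite_derive D; ring.
    - assert (Hc' : Rabs (dN c) <= L * N c) by (apply HL; lra).
      pose proof (exp_pos (- sg * L * c)).
      assert (sg * (dN c - sg * L * N c) <= 0)
        by (destruct Hsg; subst sg; revert Hc'; split_Rabs; lra).
      assert (0 <= - (sg * (dN c - sg * L * N c)) * exp (- sg * L * c)) by (apply Rmult_le_pos; lra).
      nra. }
  destruct (Rtotal_order s t) as [H | [H | H]].
  - rewrite Rabs_pos_eq by lra.
    assert (P := pos s t); rewrite Rmin_left, Rmax_right in P by lra.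
    specialize (P ltac:(lra) ltac:(lra) H 1 ltac:(now left)).
    replace (L * (t - s)) with (L * t + (- (1) * L * s)) by ring.
    rewrite exp_plus.
    replace (N t) with (N t * exp (- (1) * L * t) * exp (L * t)).
    2: { rewrite Rmult_assoc, <- exp_plus.
         replace (- (1) * L * t + L * t) with 0 by ring; rewrite exp_0; ring. }
    pose proof (exp_pos (L * t)). nra.
  - subst t; rewrite Rminus_diag, Rabs_R0, Rmult_0_r, exp_0; lra.
  - rewrite Rabs_left by lra.
    assert (P := pos t s); rewrite Rmin_right, Rmax_left in P by lra.
    specialize (P ltac:(lra) ltac:(lra) H (-1) ltac:(now right)).
    replace (L * - (t - s)) with (- L * t + (- (-1) * L * s)) by ring.
    rewrite exp_plus.
    replace (N t) with (N t * exp (- (-1) * L * t) * exp (- L * t)).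
    2: { rewrite Rmult_assoc, <- exp_plus.
         replace (- (-1) * L * t + - L * t) with 0 by ring; rewrite exp_0; ring. }
    pose proof (exp_pos (- L * t)). nra.
Qed.

(** * The Picard-Lindelof theorem *)

Section Picard.

Variables (F : R -> R -> R) (x0 M K : R).
Hypothesis HK : 1 <= K.
Hypothesis F_bounded : forall t y, Rabs (F t y) <= M.
Hypothesis F_lipschitz : forall t y z, Rabs (F t y - F t z) <= K * Rabs (y - z).
Hypothesis F_continuous :
  forall x : R -> R, (forall t, continuous x t) -> forall t, continuous (fun s => F s (x s)) t.

Fixpoint picard_iter (n : nat) : R -> R :=
  match n with
  | O => fun _ => x0
  | S n => fun t => x0 + RInt (fun s => F s (picard_iter n s)) 0 t
  end.

(** Bielecki weight, symmetrised to control both time directions. The exponent [2 * K] makes the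
    Picard operator a contraction of factor 1/2 on the whole line. *)
Definition picard_weight (t : R) : R := exp (2 * K * t) + exp (- (2 * K * t)).

Lemma picard_integrable (x : R -> R) (a b : R) :
  (forall t, continuous x t) -> ex_RInt (fun s => F s (x s)) a b.
Proof.
  intros H; apply (ex_RInt_continuous (V := R_CompleteNormedModule)); intros z _; now apply F_continuous.
Qed.

Lemma picard_iter_continuous (n : nat) (t : R) : continuous (picard_iter n) t.
Proof.
  revert t; induction n as [|n IH]; intros t; [apply continuous_const|].
  apply (continuous_plus (fun _ => x0) (fun t => RInt (fun s => F s (picard_iter n s)) 0 t)).
  - apply continuous_const.
  - apply is_derive_continuous with (F t (picard_iter n t)).
    apply (is_derive_RInt_continuous (fun s => F s (picard_iter n s))).
    now apply F_continuous.
Qed.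

Lemma picard_weight_integral (t : R) :
  is_RInt picard_weight 0 t ((exp (2 * K * t) - exp (- (2 * K * t))) / (2 * K)).
Proof.
  replace ((exp (2 * K * t) - exp (- (2 * K * t))) / (2 * K))
    with (minus ((fun t => (exp (2 * K * t) - exp (- (2 * K * t))) / (2 * K)) t)
                ((fun t => (exp (2 * K * t) - exp (- (2 * K * t))) / (2 * K)) 0)).
  2: { unfold minus, plus, opp; simpl. rewrite !Rmult_0_r, Ropp_0, exp_0; field; lra. }
  apply (is_RInt_derive (V := R_CompleteNormedModule)
           (fun t => (exp (2 * K * t) - exp (- (2 * K * t))) / (2 * K))).
  - intros s _; unfold picard_weight; auto_derive; [trivial | field; lra].
  - intros s _; apply is_derive_continuous with (2 * K * exp (2 * K * s) - 2 * K * exp (- (2 * K * s))).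
    unfold picard_weight; auto_derive; [trivial | ring].
Qed.

(** The integral of the weight is a difference of two positive exponentials over [2 * K], dominated
    by their sum: integration gains [1 / (2 * K)] in the weighted norm. *)
Lemma RInt_le_weight (f : R -> R) (c t : R) :
  0 <= c -> (forall s, continuous f s) -> (forall s, Rabs (f s) <= c * picard_weight s) ->
  Rabs (RInt f 0 t) <= c * picard_weight t / (2 * K).
Proof.
  intros Hc Hf Hb.
  assert (Hf' : forall a b, is_RInt f a b (RInt f a b)).
  { intros a b; apply (RInt_correct (V := R_CompleteNormedModule)),
      (ex_RInt_continuous (V := R_CompleteNormedModule)); intros z _; apply Hf. }
  set (v := (exp (2 * K * t) - exp (- (2 * K * t))) / (2 * K)).
  assert (W := is_RInt_scal _ 0 t c _ (picard_weight_integral t)); fold v in W.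
  assert (Hv : Rabs v <= picard_weight t / (2 * K)).
  { unfold v, picard_weight, Rdiv; rewrite Rabs_mult, (Rabs_pos_eq (/ (2 * K)))
      by (apply Rlt_le, Rinv_0_lt_compat; lra).
    apply Rmult_le_compat_r; [apply Rlt_le, Rinv_0_lt_compat; lra|].
    pose proof (exp_pos (2 * K * t)); pose proof (exp_pos (- (2 * K * t))).
    split_Rabs; lra. }
  assert (Rabs (RInt f 0 t) <= c * Rabs v).
  { destruct (Rle_dec 0 t) as [Ht | Ht].
    - apply Rle_trans with (c * v); [|pose proof (Rle_abs v); nra].
      apply (norm_RInt_le f (fun s => scal c (picard_weight s)) 0 t _ (scal c v));
        [lra | intros s _; apply Hb | apply Hf' | exact W].
    - apply Rle_trans with (c * - v); [|pose proof (Rle_abs (- v)); rewrite Rabs_Ropp in *; nra].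
      rewrite <- Rabs_Ropp.
      apply (norm_RInt_le f (fun s => scal c (picard_weight s)) t 0 (opp (RInt f 0 t)) (c * - v));
        [lra | intros s _; apply Hb | apply (is_RInt_swap (V := R_NormedModule)), Hf' | ].
      replace (c * - v) with (opp (scal c v)) by (unfold opp, scal; simpl; unfold mult; simpl; ring).
      apply (is_RInt_swap (V := R_NormedModule)); exact W. }
  unfold Rdiv; rewrite Rmult_assoc; apply Rle_trans with (1 := H).
  now apply Rmult_le_compat_l.
Qed.

Lemma picard_weight_ge (t : R) : 2 <= picard_weight t.
Proof.
  unfold picard_weight. pose proof (exp_pos (2 * K * t)).
  rewrite exp_Ropp.
  assert (/ exp (2 * K * t) * exp (2 * K * t) = 1) by (field; lra).
  pose proof (Rinv_0_lt_compat _ H).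
  assert (0 <= / exp (2 * K * t) * (exp (2 * K * t) - 1) ^ 2)
    by (apply Rmult_le_pos; [lra | apply pow2_ge_0]).
  nra.
Qed.

(** The Lipschitz constant [K] against the gain [1 / (2 * K)] halves the weighted distance at each
    iteration. *)
Lemma picard_step (n : nat) (t : R) :
  Rabs (picard_iter (S n) t - picard_iter n t) <= M * picard_weight t * (1 / 2) ^ n.
Proof.
  assert (HM : 0 <= M) by (apply Rle_trans with (2 := F_bounded 0 0), Rabs_pos).
  revert t; induction n as [|n IH]; intros t.
  - simpl. rewrite Rplus_minus_l.
    eapply Rle_trans.
    + apply RInt_le_weight with (c := M / 2); [lra| |].
      * apply (F_continuous (fun _ => x0)); intros s; apply continuous_const.
      * intros s; apply Rle_trans with (1 := F_bounded _ _); pose proof (picard_weight_ge s); nra.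
    + pose proof (picard_weight_ge t).
      apply Rmult_le_reg_r with (2 * K); [lra|].
      replace (M / 2 * picard_weight t / (2 * K) * (2 * K)) with (M / 2 * picard_weight t) by (field; lra).
      assert (0 <= M * picard_weight t) by (apply Rmult_le_pos; lra).
      nra.
  - change (picard_iter (S (S n)) t) with (x0 + RInt (fun s => F s (picard_iter (S n) s)) 0 t).
    change (picard_iter (S n) t) with (x0 + RInt (fun s => F s (picard_iter n s)) 0 t).
    assert (cancel : forall a b c : R, a + b - (a + c) = b - c) by (intros; ring).
    rewrite cancel.
    assert (E : RInt (fun s => F s (picard_iter (S n) s)) 0 t - RInt (fun s => F s (picard_iter n s)) 0 t
      = RInt (fun s => minus (F s (picard_iter (S n) s)) (F s (picard_iter n s))) 0 t).
    { symmetry.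
      apply (RInt_minus (V := R_CompleteNormedModule) (fun s => F s (picard_iter (S n) s))
               (fun s => F s (picard_iter n s)) 0 t); apply picard_integrable; intros; apply picard_iter_continuous. }
    rewrite E.
    assert (Hpow : 0 <= (1 / 2) ^ n) by (apply pow_le; lra).
    eapply Rle_trans.
    + apply RInt_le_weight with (c := K * (M * (1 / 2) ^ n)).
      * repeat apply Rmult_le_pos; lra.
      * intros s; apply (continuous_minus (fun s => F s (picard_iter (S n) s))
          (fun s => F s (picard_iter n s))); apply F_continuous; apply picard_iter_continuous.
      * intros s; apply Rle_trans with (1 := F_lipschitz _ _ _).
        rewrite Rmult_assoc; apply Rmult_le_compat_l; [lra|].
        apply Rle_trans with (1 := IH s); right; ring.
    + right; simpl; field; lra.
Qed.

(** Summing the geometric bounds of [picard_step] makes the iterates Cauchy at each time, with an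
    explicit tail that passes to the limit. *)
Lemma picard_limit : exists x : R -> R,
  forall n t, Rabs (x t - picard_iter n t) <= 2 * M * picard_weight t * (1 / 2) ^ n.
Proof.
  assert (HM : 0 <= M) by (apply Rle_trans with (2 := F_bounded 0 0), Rabs_pos).
  assert (tail : forall n m t, Rabs (picard_iter (n + m) t - picard_iter n t)
             <= 2 * M * picard_weight t * ((1 / 2) ^ n - (1 / 2) ^ (n + m))).
  { intros n m t; induction m as [|m IH].
    - rewrite Nat.add_0_r, !Rminus_diag, Rabs_R0; lra.
    - rewrite Nat.add_succ_r; simpl ((1 / 2) ^ S (n + m)).
      assert (S := picard_step (n + m) t).
      replace (picard_iter (Datatypes.S (n + m)) t - picard_iter n t)
        with ((picard_iter (Datatypes.S (n + m)) t - picard_iter (n + m) t) +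
              (picard_iter (n + m) t - picard_iter n t)) by ring.
      apply Rle_trans with (1 := Rabs_triang _ _). nra. }
  assert (tail' : forall n m t, (n <= m)%nat -> Rabs (picard_iter m t - picard_iter n t)
             <= 2 * M * picard_weight t * (1 / 2) ^ n).
  { intros n m t Hnm. replace m with (n + (m - n))%nat by lia.
    apply Rle_trans with (1 := tail _ _ _).
    assert (0 <= (1 / 2) ^ (n + (m - n))) by (apply pow_le; lra).
    pose proof (picard_weight_ge t).
    apply Rmult_le_compat_l; [nra | lra]. }
  exists (fun t => real (Lim_seq (fun n => picard_iter n t))).
  intros n t.
  assert (Hcv : ex_finite_lim_seq (fun n => picard_iter n t)).
  { apply ex_lim_seq_cauchy_corr; intros eps.
    assert (Hlim : is_lim_seq (fun n => 2 * M * picard_weight t * (1 / 2) ^ n) 0).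
    { replace (Finite 0) with (Rbar_mult (2 * M * picard_weight t) 0)
        by (simpl; f_equal; ring).
      apply is_lim_seq_scal_l, is_lim_seq_geom; rewrite Rabs_pos_eq; lra. }
    apply is_lim_seq_spec in Hlim; destruct (Hlim (pos_div_2 eps)) as [N HN].
    exists N; intros p q Hp Hq.
    specialize (HN N (le_n N)); simpl in HN; rewrite Rminus_0_r in HN.
    assert (H1 := tail' N p t Hp); assert (H2 := tail' N q t Hq).
    revert H1 H2 HN; split_Rabs; lra. }
  apply Lim_seq_correct' in Hcv.
  set (l := real (Lim_seq (fun n => picard_iter n t))) in *.
  assert (H := is_lim_seq_abs _ _ (is_lim_seq_minus' _ _ _ _ Hcv (is_lim_seq_const (picard_iter n t)))).
  apply (is_lim_seq_le_loc (fun m => Rabs (picard_iter m t - picard_iter n t))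
           (fun _ => 2 * M * picard_weight t * (1 / 2) ^ n)
           (Rabs (l - picard_iter n t)) (2 * M * picard_weight t * (1 / 2) ^ n)).
  - exists n; intros m Hm; now apply tail'.
  - exact H.
  - apply is_lim_seq_const.
Qed.

Lemma le_geometric_eq0 (a c : R) : (forall n, Rabs a <= c * (1 / 2) ^ n) -> a = 0.
Proof.
  intros H.
  assert (Hlim : is_lim_seq (fun n => c * (1 / 2) ^ n) 0).
  { replace (Finite 0) with (Rbar_mult c 0) by (simpl; f_equal; ring).
    apply is_lim_seq_scal_l, is_lim_seq_geom; rewrite Rabs_pos_eq; lra. }
  assert (Rabs a <= 0).
  { exact (is_lim_seq_le (fun _ => Rabs a) _ (Rabs a) 0 H (is_lim_seq_const _) Hlim). }
  revert H0; split_Rabs; lra.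
Qed.

Lemma picard_lindelof_0 : exists x : R -> R, x 0 = x0 /\ forall t, is_derive x t (F t (x t)).
Proof.
  assert (HM : 0 <= M) by (apply Rle_trans with (2 := F_bounded 0 0), Rabs_pos).
  destruct picard_limit as [x Hx].
  assert (Hpow : forall n, 0 <= (1 / 2) ^ n) by (intros n; apply pow_le; lra).
  (* All iterates share the Lipschitz constant [M], since [F] is bounded by [M]; the limit inherits
     it and is therefore continuous. *)
  assert (Hiter : forall n s t, Rabs (picard_iter n t - picard_iter n s) <= M * Rabs (t - s)).
  { intros [|n] s t.
    - simpl; rewrite Rminus_diag, Rabs_R0; apply Rmult_le_pos; [lra | apply Rabs_pos].
    - assert (D : forall u, is_derive (picard_iter (S n)) u (F u (picard_iter n u))).
      { intros u; simpl.
        replace (F u (picard_iter n u)) with (plus zero (F u (picard_iter n u)))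
          by apply plus_zero_l.
        apply (is_derive_plus (fun _ => x0) (RInt (fun s => F s (picard_iter n s)) 0)).
        - apply (is_derive_const x0 u).
        - apply (is_derive_RInt_continuous (fun s => F s (picard_iter n s))).
          apply F_continuous, picard_iter_continuous. }
      destruct (MVT_gen (picard_iter (S n)) s t (fun u => F u (picard_iter n u))) as [c [_ E]].
      + intros u _; apply D.
      + intros u _; apply continuity_pt_filterlim, picard_iter_continuous.
      + rewrite E, Rabs_mult; apply Rmult_le_compat_r; [apply Rabs_pos | apply F_bounded]. }
  assert (Hcont : forall t, continuous x t).
  { intros t; apply continuous_lipschitz with M; intros s.
    assert (L1 : forall u, is_lim_seq (fun n => picard_iter n u) (x u)).
    { intros u; apply is_lim_seq_spec; intros eps.
      assert (Hlim : is_lim_seq (fun n => 2 * M * picard_weight u * (1 / 2) ^ n) 0).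
      { replace (Finite 0) with (Rbar_mult (2 * M * picard_weight u) 0)
          by (simpl; f_equal; ring).
        apply is_lim_seq_scal_l, is_lim_seq_geom; rewrite Rabs_pos_eq; lra. }
      apply is_lim_seq_spec in Hlim; destruct (Hlim eps) as [N HN].
      exists N; intros n Hn; specialize (HN n Hn); specialize (Hx n u).
      revert Hx HN; split_Rabs; lra. }
    apply (is_lim_seq_le (fun n => Rabs (picard_iter n s - picard_iter n t)) (fun _ => M * Rabs (s - t))
             (Rabs (x s - x t)) (M * Rabs (s - t))).
    - intros n; apply Hiter.
    - exact (is_lim_seq_abs _ _ (is_lim_seq_minus' _ _ _ _ (L1 s) (L1 t))).
    - apply is_lim_seq_const. }
  (* The defect is split at the iterate [S n]: its distance to [x] and the distance of the two
     integrals are each at most [M * picard_weight t * (1 / 2) ^ n]. *)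
  assert (Hfix : forall t, x t = x0 + RInt (fun s => F s (x s)) 0 t).
  { intros t; apply Rminus_diag_uniq.
    apply le_geometric_eq0 with (3 * M * picard_weight t); intros n.
    assert (H1 := Hx (S n) t).
    assert (H2 : Rabs (RInt (fun s => minus (F s (picard_iter n s)) (F s (x s))) 0 t)
                 <= K * (2 * M * (1 / 2) ^ n) * picard_weight t / (2 * K)).
    { apply RInt_le_weight.
      - specialize (Hpow n). repeat apply Rmult_le_pos; lra.
      - intros s; apply (continuous_minus (fun s => F s (picard_iter n s))
          (fun s => F s (x s))); apply F_continuous; [apply picard_iter_continuous | apply Hcont].
      - intros s; apply Rle_trans with (1 := F_lipschitz _ _ _).
        rewrite Rmult_assoc; apply Rmult_le_compat_l; [lra|].
        rewrite Rabs_minus_sym; apply Rle_trans with (1 := Hx n s); right; ring. }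
    assert (E : RInt (fun s => minus (F s (picard_iter n s)) (F s (x s))) 0 t
      = RInt (fun s => F s (picard_iter n s)) 0 t - RInt (fun s => F s (x s)) 0 t).
    { apply (RInt_minus (V := R_CompleteNormedModule) (fun s => F s (picard_iter n s))
               (fun s => F s (x s)) 0 t); apply picard_integrable;
        [apply picard_iter_continuous | apply Hcont]. }
    rewrite E in H2.
    replace (K * (2 * M * (1 / 2) ^ n) * picard_weight t / (2 * K))
      with (M * picard_weight t * (1 / 2) ^ n) in H2 by (field; lra).
    simpl in H1.
    assert (0 <= M * picard_weight t * (1 / 2) ^ n).
    { pose proof (picard_weight_ge t). specialize (Hpow n). repeat apply Rmult_le_pos; lra. }
    revert H1 H2; split_Rabs; lra. }
  exists x; split.
  - rewrite Hfix, RInt_point; unfold zero; simpl; ring.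
  - intros t. apply (is_derive_ext (fun t => plus x0 (RInt (fun s => F s (x s)) 0 t))).
    { intros u; symmetry; apply Hfix. }
    replace (F t (x t)) with (plus zero (F t (x t))) by apply plus_zero_l.
    apply (is_derive_plus (fun _ => x0) (RInt (fun s => F s (x s)) 0)).
    + apply (is_derive_const x0 t).
    + apply (is_derive_RInt_continuous (fun s => F s (x s))).
      now apply F_continuous.
Qed.

End Picard.

Lemma picard_lindelof (F : R -> R -> R) (t0 x0 M K : R) :
  1 <= K ->
  (forall t y, Rabs (F t y) <= M) ->
  (forall t y z, Rabs (F t y - F t z) <= K * Rabs (y - z)) ->
  (forall x : R -> R, (forall t, continuous x t) -> forall t, continuous (fun s => F s (x s)) t) ->
  exists x : R -> R, x t0 = x0 /\ forall t, is_derive x t (F t (x t)).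
Proof.
  intros HK HM HL HF.
  destruct (picard_lindelof_0 (fun t y => F (t + t0) y) x0 M K HK) as [x [H0 Hx]].
  - intros t y; apply HM.
  - intros t y z; apply HL.
  - intros x Hx t.
    apply (continuous_ext (fun s => F (s + t0) (x (s + t0 - t0)))).
    { intros s; f_equal; f_equal; ring. }
    apply (continuous_comp (fun s => s + t0) (fun s => F s (x (s - t0)))).
    + apply (continuous_plus (fun s => s) (fun _ => t0)); [apply continuous_id | apply continuous_const].
    + apply (HF (fun s => x (s - t0))). intros s.
      apply (continuous_comp (fun s => s - t0) x); [|apply Hx].
      apply (continuous_minus (fun s => s) (fun _ => t0)); [apply continuous_id | apply continuous_const].
  - exists (fun t => x (t - t0)); split; [rewrite Rminus_diag; exact H0|].
    intros t. specialize (Hx (t - t0)); cbv beta in Hx.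
    assert (E : forall u : R, u - t0 + t0 = u) by (intros; ring); rewrite E in Hx.
    auto_derive; [now exists (F t (x (t - t0)))|].
    change (t + - t0) with (t - t0); rewrite_derive Hx; ring.
Qed.

(** * Solutions of the Abel equation and the Poincare map *)

(* The right-hand side frozen outside [0,1] x [-m,m]: a bounded, globally Lipschitz field. *)
Definition abel_cut (A B : R -> R) (m t y : R) : R :=
  A (clamp 0 1 t) * clamp (- m) m y ^ 3 + B (clamp 0 1 t) * clamp (- m) m y ^ 2.

Lemma continuous_pow (f : R -> R) (n : nat) (t : R) :
  continuous f t -> continuous (fun s => f s ^ n) t.
Proof.
  intros H; apply (continuous_comp f (fun u => u ^ n)); [exact H|].
  apply is_derive_continuous with (INR n * 1 * f t ^ pred n).
  auto_derive; [trivial | ring].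
Qed.

Lemma continuous_add (f g : R -> R) (t : R) :
  continuous f t -> continuous g t -> continuous (fun s => f s + g s) t.
Proof. exact (continuous_plus f g t). Qed.

Lemma continuous_mul (f g : R -> R) (t : R) :
  continuous f t -> continuous g t -> continuous (fun s => f s * g s) t.
Proof. exact (continuous_mult f g t). Qed.

Lemma continuous_cst (c t : R) : continuous (fun _ : R => c) t.
Proof. exact (continuous_const c t). Qed.

Ltac continuity_tac :=
  repeat first [ apply continuous_pow | apply continuous_add | apply continuous_mul
               | apply continuous_cst ].

Lemma Rabs_mult_le (a b c d : R) : Rabs a <= c -> Rabs b <= d -> Rabs (a * b) <= c * d.
Proof. intros; rewrite Rabs_mult; apply Rmult_le_compat; auto using Rabs_pos. Qed.

Lemma Rabs_plus_le (a b c d : R) : Rabs a <= c -> Rabs b <= d -> Rabs (a + b) <= c + d.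
Proof. intros; apply Rle_trans with (1 := Rabs_triang _ _); lra. Qed.

Lemma Rabs_pow_le (a c : R) (n : nat) : Rabs a <= c -> Rabs (a ^ n) <= c ^ n.
Proof. intros; rewrite <- RPow_abs; apply pow_incr; split; auto using Rabs_pos. Qed.

(** * Global solvability of the truncated equation *)

Section Cut.

Variables (A B : R -> R) (m : R).
Hypothesis Hm : 0 < m.
Hypothesis HA : forall t, 0 <= t <= 1 -> continuous A t.
Hypothesis HB : forall t, 0 <= t <= 1 -> continuous B t.

Lemma clamp_abs (y : R) : Rabs (clamp (- m) m y) <= m.
Proof. apply Rabs_le, clamp_bounds; lra. Qed.

Lemma abel_cut_bounds : exists M K, 1 <= K /\
  (forall t y, Rabs (abel_cut A B m t y) <= M) /\
  (forall t y z, Rabs (abel_cut A B m t y - abel_cut A B m t z) <= K * Rabs (y - z)).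
Proof.
  destruct (bounded_on A 0 1 HA) as [a [Ha Ha']].
  destruct (bounded_on B 0 1 HB) as [b [Hb Hb']].
  exists (a * m ^ 3 + b * m ^ 2), (a * (m ^ 2 + m * m + m ^ 2) + b * (m + m) + 1).
  assert (Hm2 := pow2_ge_0 m).
  assert (T : forall t, 0 <= clamp 0 1 t <= 1) by (intros; apply clamp_bounds; lra).
  assert (P : 0 <= a * (m ^ 2 + m * m + m ^ 2) + b * (m + m)).
  { apply Rplus_le_le_0_compat; apply Rmult_le_pos; nra. }
  split; [lra | split].
  - intros t y; unfold abel_cut.
    apply Rabs_plus_le; apply Rabs_mult_le; auto; apply Rabs_pow_le, clamp_abs.
  - intros t y z; unfold abel_cut.
    set (u := clamp (- m) m y); set (v := clamp (- m) m z); set (T' := clamp 0 1 t).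
    replace (A T' * u ^ 3 + B T' * u ^ 2 - (A T' * v ^ 3 + B T' * v ^ 2))
      with ((A T' * (u ^ 2 + u * v + v ^ 2) + B T' * (u + v)) * (u - v)) by ring.
    apply Rabs_mult_le; [|apply clamp_lipschitz].
    apply Rle_trans with (a * (m ^ 2 + m * m + m ^ 2) + b * (m + m)); [|lra].
    apply Rabs_plus_le; apply Rabs_mult_le; unfold T'; auto;
      repeat apply Rabs_plus_le; try apply Rabs_pow_le; try apply Rabs_mult_le; apply clamp_abs.
Qed.

Lemma abel_cut_continuous (x : R -> R) :
  (forall t, continuous x t) -> forall t, continuous (fun s => abel_cut A B m s (x s)) t.
Proof.
  intros Hx t; unfold abel_cut.
  assert (T : 0 <= clamp 0 1 t <= 1) by (apply clamp_bounds; lra).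
  continuity_tac.
  - apply (continuous_comp (clamp 0 1) A); [apply clamp_continuous | now apply HA].
  - apply (continuous_comp x (clamp (- m) m)); [apply Hx | apply clamp_continuous].
  - apply (continuous_comp (clamp 0 1) B); [apply clamp_continuous | now apply HB].
  - apply (continuous_comp x (clamp (- m) m)); [apply Hx | apply clamp_continuous].
Qed.

Lemma abel_cut_solution (t0 x0 : R) :
  exists x : R -> R, x t0 = x0 /\ forall t, is_derive x t (abel_cut A B m t (x t)).
Proof.
  destruct abel_cut_bounds as [M [K [HK [H1 H2]]]].
  exact (picard_lindelof (abel_cut A B m) t0 x0 M K HK H1 H2 abel_cut_continuous).
Qed.

End Cut.

Lemma abel_cut_id (A B : R -> R) (m t y : R) :
  0 <= t <= 1 -> Rabs y <= m -> abel_cut A B m t y = A t * y ^ 3 + B t * y ^ 2.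
Proof.
  intros Ht Hy; unfold abel_cut; rewrite !clamp_id; auto.
  revert Hy; split_Rabs; lra.
Qed.

Lemma is_sol_continuous (A B x : R -> R) (t : R) :
  is_sol A B x -> 0 <= t <= 1 -> continuous x t.
Proof. intros Hx Ht; exact (is_derive_continuous _ _ _ (Hx t Ht)). Qed.

(** Gronwall is applied to squared distances, which are differentiable; this takes the square root
    of the resulting bound. *)
Lemma abs_le_sqrt_exp (a b L : R) : 0 <= b -> a ^ 2 <= b ^ 2 * exp (2 * L) -> Rabs a <= b * exp L.
Proof.
  intros Hb H.
  replace (2 * L) with (L + L) in H by ring; rewrite exp_plus in H.
  pose proof (exp_pos L).
  rewrite <- (Rabs_pos_eq (b * exp L)) by (apply Rmult_le_pos; lra).
  apply Rsqr_le_abs_0; unfold Rsqr; lra.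
Qed.

Lemma linear_ode (p d I : R -> R) :
  (forall t, 0 <= t <= 1 -> is_derive I t (p t)) ->
  (forall t, 0 <= t <= 1 -> is_derive d t (p t * d t)) ->
  forall t, 0 <= t <= 1 -> d t = d 0 * exp (I t - I 0).
Proof.
  intros HI Hd t Ht.
  assert (E : d t * exp (- I t) = d 0 * exp (- I 0)).
  { destruct (Req_dec t 0) as [-> | Hn]; [reflexivity|].
    destruct (mvt (fun s => d s * exp (- I s)) (fun _ => 0) 0 t) as [c [_ Hc]]; [lra| |lra].
    intros s Hs.
    assert (D1 : is_derive d s (p s * d s)) by (apply Hd; lra).
    assert (D2 : is_derive I s (p s)) by (apply HI; lra).
    auto_derive; [repeat split; eexists; eassumption|].
    rewrite_derive D1; rewrite_derive D2; ring. }
  replace (exp (I t - I 0)) with (exp (- I 0) * exp (I t)) by (rewrite <- exp_plus; f_equal; ring).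
  rewrite <- Rmult_assoc, <- E, Rmult_assoc, <- exp_plus, Rplus_opp_l, exp_0; ring.
Qed.

(* The difference of two solutions solves a linear equation with this coefficient. *)
Definition diff_coef (A B x y : R -> R) (t : R) : R :=
  A t * (x t ^ 2 + x t * y t + y t ^ 2) + B t * (x t + y t).

(** * Uniqueness, dependence on the initial value, derivative of the Poincare map *)

Section Solutions.

Variables (A B : R -> R).
Hypothesis HA : forall t, 0 <= t <= 1 -> continuous A t.
Hypothesis HB : forall t, 0 <= t <= 1 -> continuous B t.

Lemma diff_coef_primitive (x y : R -> R) :
  (forall t, 0 <= t <= 1 -> continuous x t) -> (forall t, 0 <= t <= 1 -> continuous y t) ->
  exists I : R -> R, forall t, 0 <= t <= 1 -> is_derive I t (diff_coef A B x y t).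
Proof.
  intros Hx Hy; apply primitive_unit; intros t Ht; unfold diff_coef.
  continuity_tac; auto.
Qed.

Lemma sol_diff (x y I : R -> R) :
  is_sol A B x -> is_sol A B y ->
  (forall t, 0 <= t <= 1 -> is_derive I t (diff_coef A B x y t)) ->
  forall t, 0 <= t <= 1 -> x t - y t = (x 0 - y 0) * exp (I t - I 0).
Proof.
  intros Hx Hy HI; apply (linear_ode (diff_coef A B x y) (fun t => x t - y t) I HI).
  intros t Ht; assert (D1 := Hx t Ht); assert (D2 := Hy t Ht).
  auto_derive; [repeat split; eexists; eassumption|].
  rewrite_derive D1; rewrite_derive D2; unfold diff_coef; ring.
Qed.

(** The difference of two solutions is its initial value times an exponential, so it vanishes
    everywhere or nowhere on [0,1]. *)
Lemma sol_neq (x y : R -> R) (s t : R) :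
  is_sol A B x -> is_sol A B y -> 0 <= s <= 1 -> 0 <= t <= 1 -> x s <> y s -> x t <> y t.
Proof.
  intros Hx Hy Hs Ht Hn E.
  destruct (diff_coef_primitive x y) as [I HI];
    try (intros u Hu; eapply is_sol_continuous; eassumption).
  assert (E1 := sol_diff x y I Hx Hy HI s Hs); assert (E2 := sol_diff x y I Hx Hy HI t Ht).
  pose proof (exp_pos (I t - I 0)).
  assert (x 0 - y 0 = 0) by (destruct (Rmult_integral (x 0 - y 0) (exp (I t - I 0))); lra).
  apply Hn; rewrite H0 in E1; lra.
Qed.

Lemma is_sol_zero : is_sol A B (fun _ => 0).
Proof. intros t _; auto_derive; [trivial | ring]. Qed.

Lemma sol_nonzero (x : R -> R) (s t : R) :
  is_sol A B x -> 0 <= s <= 1 -> 0 <= t <= 1 -> x s <> 0 -> x t <> 0.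
Proof. intros Hx Hs Ht; apply (sol_neq x (fun _ => 0) s t Hx is_sol_zero Hs Ht). Qed.

(** Uniqueness forces the value chosen by [epsilon] to be the endpoint of the given solution. *)
Lemma poincare_eq (x : R -> R) : is_sol A B x -> poincare A B (x 0) = x 1.
Proof.
  intros Hx; unfold poincare.
  assert (H := epsilon_spec (inhabits 0) (fun y => poincare_rel A B (x 0) y)
                 (ex_intro _ (x 1) (ex_intro _ x (conj Hx (conj eq_refl eq_refl))))).
  cbv beta in H; destruct H as [y [Hy [H0 H1]]].
  rewrite <- H1; destruct (Req_dec (y 1) (x 1)) as [E | E]; [exact E|].
  exfalso; apply (sol_neq y x 1 0 Hy Hx) in E; lra.
Qed.

(** With [m] a bound of [x], the field cut at height [m + 1] has a solution from every initial
    value. By Gronwall it stays within distance 1 of [x] when [y0] is within [1 / exp K] of [x 0],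
    so the cut is never active along it. *)
Lemma sol_nearby (x : R -> R) :
  is_sol A B x ->
  exists delta L, 0 < delta /\ 0 < L /\ forall y0, Rabs (y0 - x 0) < delta ->
    exists y, is_sol A B y /\ y 0 = y0 /\
      forall t, 0 <= t <= 1 -> Rabs (y t - x t) <= L * Rabs (y0 - x 0).
Proof.
  intros Hx.
  destruct (bounded_on x 0 1) as [m [Hm Hxm]].
  { intros t Ht; exact (is_sol_continuous A B x t Hx Ht). }
  destruct (abel_cut_bounds A B (m + 1)) as [M [K [HK [_ HL]]]]; [lra | assumption.. |].
  assert (HeK := exp_pos K).
  exists (1 / exp K), (exp K); split; [apply Rdiv_lt_0_compat; lra | split; [assumption|]].
  intros y0 Hy0.
  destruct (abel_cut_solution A B (m + 1)) with (t0 := 0) (x0 := y0)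
    as [y [H0 Hy]]; [lra | assumption.. |].
  assert (close : forall t, 0 <= t <= 1 -> Rabs (y t - x t) <= exp K * Rabs (y0 - x 0)).
  { intros t Ht.
    rewrite Rmult_comm; apply abs_le_sqrt_exp; [apply Rabs_pos|].
    rewrite pow2_abs, <- H0.
    apply Rle_trans with ((y 0 - x 0) ^ 2 * exp (2 * K * Rabs (t - 0))).
    - apply (gronwall_two_sided (fun s => (y s - x s) ^ 2)
        (fun s => 2 * (y s - x s) * (abel_cut A B (m + 1) s (y s) - abel_cut A B (m + 1) s (x s))));
        rewrite Rmin_left, Rmax_right by lra; intros s Hs.
      + assert (D1 := Hy s); assert (D2 := Hx s ltac:(lra)).
        auto_derive; [repeat split; eexists; eassumption|].
        rewrite_derive D1; rewrite_derive D2.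
        rewrite (abel_cut_id A B (m + 1) s (x s)); [ring | lra |].
        specialize (Hxm s); lra.
      + replace (2 * K * (y s - x s) ^ 2) with (2 * Rabs (y s - x s) * (K * Rabs (y s - x s))).
        2: { rewrite <- pow2_abs; ring. }
        rewrite !Rabs_mult, (Rabs_pos_eq 2) by lra.
        apply Rmult_le_compat_l; [pose proof (Rabs_pos (y s - x s)); lra | apply HL].
    - apply Rmult_le_compat_l; [apply pow2_ge_0|].
      rewrite Rabs_pos_eq by lra.
      destruct (Req_dec t 1) as [-> | Hn]; [right; f_equal; ring|].
      apply Rlt_le, exp_increasing; nra. }
  exists y; split; [|split; [exact H0 | exact close]].
  intros t Ht; rewrite <- (abel_cut_id A B (m + 1) t (y t) Ht); [apply Hy|].
  assert (exp K * Rabs (y0 - x 0) < 1).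
  { apply Rmult_lt_compat_l with (r := exp K) in Hy0; [|assumption].
    replace (exp K * (1 / exp K)) with 1 in Hy0 by (field; lra); exact Hy0. }
  specialize (close t Ht); specialize (Hxm t Ht).
  revert close Hxm; split_Rabs; lra.
Qed.

(** The difference quotient is exactly the exponential of the integral of [diff_coef], and this
    integral tends to that of [3 A x^2 + 2 B x] as the second solution tends to [x]. *)
Lemma poincare_derive (x I : R -> R) :
  is_sol A B x ->
  (forall t, 0 <= t <= 1 -> is_derive I t (3 * A t * x t ^ 2 + 2 * B t * x t)) ->
  is_derive (poincare A B) (x 0) (exp (I 1 - I 0)).
Proof.
  intros Hx HI.
  destruct (sol_nearby x Hx) as [delta [L [Hd [HL near]]]].
  destruct (bounded_on A 0 1 HA) as [a [Ha Ha']].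
  destruct (bounded_on B 0 1 HB) as [b [Hb Hb']].
  destruct (bounded_on x 0 1) as [m [Hm Hxm]].
  { intros t Ht; exact (is_sol_continuous A B x t Hx Ht). }
  apply is_derive_Reals; intros eps Heps.
  assert (Hexp : continuous exp (I 1 - I 0)).
  { apply is_derive_continuous with (exp (I 1 - I 0)); auto_derive; [trivial | ring]. }
  apply filterlim_locally with (eps := mkposreal eps Heps) in Hexp.
  destruct Hexp as [eta Heta]; simpl in Heta.
  (* The two exponents differ by at most [Q * Rabs h]: their integrands differ by
     [(A (3 x + (y - x)) + B) (y - x)], where [y - x] is at most [L * Rabs h]. *)
  set (Q := (a * (3 * m + L * delta) + b) * L).
  assert (HQ : 0 < Q).
  { unfold Q; assert (0 < L * delta) by (apply Rmult_lt_0_compat; lra).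
    apply Rmult_lt_0_compat; [|lra]. assert (0 < a * (3 * m + L * delta)) by (apply Rmult_lt_0_compat; lra). lra. }
  assert (Hmin : 0 < Rmin delta (eta / Q)).
  { apply Rmin_pos; [lra | apply Rdiv_lt_0_compat; [apply cond_pos | lra]]. }
  exists (mkposreal _ Hmin); intros h Hh0 Hh; simpl in Hh.
  assert (Hh1 : Rabs h < delta) by (apply Rlt_le_trans with (1 := Hh), Rmin_l).
  assert (Hh2 : Rabs h < eta / Q) by (apply Rlt_le_trans with (1 := Hh), Rmin_r).
  destruct (near (x 0 + h)) as [y [Hy [Hy0 Hyx]]].
  { replace (x 0 + h - x 0) with h by ring; assumption. }
  replace (x 0 + h - x 0) with h in Hyx by ring.
  rewrite <- Hy0, !poincare_eq by assumption.
  destruct (diff_coef_primitive y x) as [J HJ];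
    try (intros u Hu; eapply is_sol_continuous; eassumption).
  rewrite (sol_diff y x J Hy Hx HJ 1) by lra.
  replace ((y 0 - x 0) * exp (J 1 - J 0) / h) with (exp (J 1 - J 0)) by (rewrite Hy0; field; lra).
  apply Heta.
  change (Rabs ((J 1 - J 0) - (I 1 - I 0)) < eta).
  destruct (mvt (fun t => J t - I t)
    (fun t => diff_coef A B y x t - (3 * A t * x t ^ 2 + 2 * B t * x t)) 0 1) as [c [Hc E]]; [lra| |].
  { intros t Ht; assert (D1 := HJ t Ht); assert (D2 := HI t Ht).
    auto_derive; [repeat split; eexists; eassumption|].
    rewrite_derive D1; rewrite_derive D2; ring. }
  replace (J 1 - J 0 - (I 1 - I 0)) with (J 1 - I 1 - (J 0 - I 0)) by ring.
  rewrite E; unfold diff_coef.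
  replace ((A c * (y c ^ 2 + y c * x c + x c ^ 2) + B c * (y c + x c) -
     (3 * A c * x c ^ 2 + 2 * B c * x c)) * (1 - 0))
    with ((A c * (3 * x c + (y c - x c)) + B c) * (y c - x c)) by ring.
  assert (Hc' : 0 <= c <= 1) by lra.
  apply Rle_lt_trans with (Q * Rabs h).
  - unfold Q; rewrite Rmult_assoc; apply Rabs_mult_le; [|now apply Hyx].
    apply Rabs_plus_le; [|now apply Hb'].
    apply Rabs_mult_le; [now apply Ha'|].
    apply Rabs_plus_le.
    + rewrite Rabs_mult, (Rabs_pos_eq 3) by lra; specialize (Hxm c Hc'); lra.
    + apply Rle_trans with (1 := Hyx c Hc'), Rmult_le_compat_l; [lra | lra].
  - apply Rmult_lt_compat_l with (r := Q) in Hh2; [|assumption].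
    replace (Q * (eta / Q)) with (pos eta) in Hh2 by (field; lra); exact Hh2.
Qed.

(** The logarithm of the square serves as twice [ln |f|] for either sign of [f]. *)
Lemma is_derive_ln_sqr (f : R -> R) (t l : R) :
  is_derive f t l -> f t <> 0 -> is_derive (fun s => ln (f s ^ 2)) t (2 * l / f t).
Proof.
  intros D Hn.
  assert (0 < f t ^ 2) by (simpl; nra).
  auto_derive; [split; [now exists l | simpl in H; lra]|].
  rewrite_derive D; field; assumption.
Qed.

(* Along a periodic solution [int (A x^2 + B x) = int x'/x = 0], so the logarithm of the
   multiplier [int (3 A x^2 + 2 B x)] equals [int A x^2]. *)
Lemma hyperbolic_of_multiplier (x J : R -> R) :
  is_sol A B x -> x 0 <> 0 -> x 0 = x 1 ->
  (forall t, 0 <= t <= 1 -> is_derive J t (A t * x t ^ 2)) -> J 0 <> J 1 ->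
  hyperbolic A B (x 0).
Proof.
  intros Hx Hx0 Hper HJ HJn.
  assert (Hn : forall t, 0 <= t <= 1 -> x t <> 0).
  { intros t Ht; apply (sol_nonzero x 0 t Hx); lra. }
  assert (D : is_derive (poincare A B) (x 0)
     (exp ((J 1 + ln (x 1 ^ 2)) - (J 0 + ln (x 0 ^ 2))))).
  { apply (poincare_derive x (fun t => J t + ln (x t ^ 2)) Hx).
    intros t Ht; assert (D1 := HJ t Ht).
    assert (D2 := is_derive_ln_sqr x t _ (Hx t Ht) (Hn t Ht)).
    replace (3 * A t * x t ^ 2 + 2 * B t * x t) with
      (plus (A t * x t ^ 2) (2 * (A t * x t ^ 3 + B t * x t ^ 2) / x t))
      by (unfold plus; simpl; field; now apply Hn).
    exact (is_derive_plus J (fun t => ln (x t ^ 2)) t _ _ D1 D2). }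
  split; [|split].
  - exists x; auto.
  - eexists; exact D.
  - rewrite (is_derive_unique _ _ _ D), <- Hper.
    replace (J 1 + ln (x 0 ^ 2) - (J 0 + ln (x 0 ^ 2))) with (J 1 - J 0) by ring.
    intros E; apply HJn; pose proof exp_0; assert (J 1 - J 0 = 0) by (apply exp_inv; lra); lra.
Qed.

End Solutions.

(** * Centers *)

Lemma const0_of_linear_bound (a C delta : R) :
  0 < delta -> (forall h, 0 < h < delta -> Rabs a <= C * h) -> a = 0.
Proof.
  intros Hd H; destruct (Req_dec a 0) as [E | E]; [exact E|exfalso].
  assert (Ha := Rabs_pos_lt a E).
  assert (HC := Rle_abs C); pose proof (Rabs_pos C).
  (* Small enough that [C * h] is at most half of [Rabs a]. *)
  set (h := Rmin (delta / 2) (Rabs a / (2 * (Rabs C + 1)))).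
  assert (h1 : h <= delta / 2) by apply Rmin_l.
  assert (h2 : h <= Rabs a / (2 * (Rabs C + 1))) by apply Rmin_r.
  assert (h0 : 0 < h) by (apply Rmin_pos; [lra | apply Rdiv_lt_0_compat; lra]).
  specialize (H h ltac:(lra)).
  apply Rmult_le_compat_l with (r := 2 * (Rabs C + 1)) in h2; [|lra].
  replace (2 * (Rabs C + 1) * (Rabs a / (2 * (Rabs C + 1)))) with (Rabs a) in h2 by (field; lra).
  nra.
Qed.

Section Center.

Variables (A B IA IB IAB : R -> R).
Hypothesis HA : forall t, 0 <= t <= 1 -> continuous A t.
Hypothesis HB : forall t, 0 <= t <= 1 -> continuous B t.
Hypothesis HIA : forall t, 0 <= t <= 1 -> is_derive IA t (A t).
Hypothesis HIB : forall t, 0 <= t <= 1 -> is_derive IB t (B t).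
Hypothesis HIAB : forall t, 0 <= t <= 1 -> is_derive IAB t (A t * IB t).
Hypothesis IA0 : IA 0 = 0.
Hypothesis IB0 : IB 0 = 0.

(** A center makes the solution from [h] periodic, and [sol_nearby] at the zero solution makes it
    O(h); uniqueness identifies the two solutions obtained. *)
Lemma center_small_orbits :
  has_center_at_0 A B ->
  exists delta L, 0 < delta /\ forall h, 0 < h < delta ->
    exists x, is_sol A B x /\ x 0 = x 1 /\
      forall t, 0 <= t <= 1 -> x t <> 0 /\ Rabs (x t) <= L * h.
Proof.
  intros [d1 [Hd1 Hc]].
  destruct (sol_nearby A B HA HB _ (is_sol_zero A B)) as [d2 [L [Hd2 [HL near]]]].
  exists (Rmin d1 d2), L; split; [now apply Rmin_pos|].
  intros h Hh.
  assert (Hh1 : h < d1) by (pose proof (Rmin_l d1 d2); lra).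
  assert (Hh2 : h < d2) by (pose proof (Rmin_r d1 d2); lra).
  destruct (Hc h) as [x [Hx [H0 H1]]]; [rewrite Rabs_pos_eq; lra|].
  destruct (near h) as [y [Hy [Hy0 Hyx]]]; [rewrite Rminus_0_r, Rabs_pos_eq; lra|].
  exists x; split; [exact Hx | split; [lra|]].
  intros t Ht; split.
  - apply (sol_nonzero A B HA HB x 0 t Hx); lra.
  - assert (E : x t = y t).
    { destruct (Req_dec (x t) (y t)) as [E | E]; [exact E|].
      exfalso; apply (sol_neq A B HA HB x y t 0 Hx Hy) in E; lra. }
    specialize (Hyx t Ht); rewrite !Rminus_0_r, (Rabs_pos_eq h) in Hyx by lra.
    now rewrite E.
Qed.

(* With [W = 1/x + IB] along a solution, [W' = - A x]; pairing it with [IA] and [IAB]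
   makes the successive Lyapunov quantities appear as exact derivatives up to O(x). *)
Lemma center_integrals :
  has_center_at_0 A B -> IB 1 = 0 /\ IA 1 = 0 /\ IAB 1 = IAB 0.
Proof.
  intros Hc; destruct (center_small_orbits Hc) as [delta [L [Hd orb]]].
  destruct (bounded_on A 0 1 HA) as [a [Ha Ha']].
  destruct (bounded_on IA 0 1) as [ia [Hia Hia']].
  { intros t Ht; exact (is_derive_continuous _ _ _ (HIA t Ht)). }
  destruct (bounded_on IB 0 1) as [ib [Hib Hib']].
  { intros t Ht; exact (is_derive_continuous _ _ _ (HIB t Ht)). }
  assert (DW : forall x, is_sol A B x -> forall t, 0 <= t <= 1 -> x t <> 0 ->
            is_derive (fun s => / x s + IB s) t (- (A t * x t))).
  { intros x Hx t Ht Hn; assert (D1 := Hx t Ht); assert (D2 := HIB t Ht).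
    auto_derive; [repeat split; auto; eexists; eassumption|].
    rewrite_derive D1; rewrite_derive D2; field; exact Hn. }
  assert (E1 : IB 1 = 0).
  { apply const0_of_linear_bound with (a * L) delta; [assumption|]; intros h Hh.
    destruct (orb h Hh) as [x [Hx [Hper Hxt]]].
    destruct (mvt _ _ 0 1 ltac:(lra) (fun t Ht => DW x Hx t Ht (proj1 (Hxt t Ht)))) as [c [Hc' E]].
    replace (IB 1) with (- (A c * x c) * (1 - 0)) by (rewrite <- E, Hper; lra).
    replace (- (A c * x c) * (1 - 0)) with (- (A c * x c)) by ring.
    rewrite Rabs_Ropp, Rmult_assoc; apply Rabs_mult_le; [apply Ha' | apply Hxt]; lra. }
  assert (E2 : IA 1 = 0).
  { apply const0_of_linear_bound with (a * ib * L) delta; [assumption|]; intros h Hh.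
    destruct (orb h Hh) as [x [Hx [Hper Hxt]]].
    destruct (mvt (fun s => (/ x s + IB s) ^ 2 / 2 + IA s) (fun s => - (A s * IB s * x s)) 0 1)
      as [c [Hc' E]]; [lra| |].
    { intros t Ht; assert (D1 := DW x Hx t Ht (proj1 (Hxt t Ht))); assert (D2 := HIA t Ht).
      set (W := fun s : R => / x s + IB s); change (is_derive W t (- (A t * x t))) in D1.
      (* This identity turns [A * (x * W)] into [A + A * x * IB]: the terms free of [x] cancel and
         an O(h) remainder is left. *)
      assert (EW : x t * W t = 1 + x t * IB t) by (unfold W; field; now apply Hxt).
      change (is_derive (fun s => W s ^ 2 / 2 + IA s) t (- (A t * IB t * x t))); clearbody W.
      auto_derive; [repeat split; auto; eexists; eassumption|].
      rewrite_derive D1; rewrite_derive D2.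
      transitivity (- (A t * (x t * W t)) + A t); [field | rewrite EW; ring]. }
    replace (IA 1) with (- (A c * IB c * x c) * (1 - 0)) by (rewrite <- E, Hper, E1, IA0, IB0; lra).
    replace (- (A c * IB c * x c) * (1 - 0)) with (- (A c * IB c * x c)) by ring.
    rewrite Rabs_Ropp, (Rmult_assoc (a * ib)).
    apply Rabs_mult_le; [apply Rabs_mult_le; [apply Ha' | apply Hib'] | apply Hxt]; lra. }
  split; [exact E1 | split; [exact E2|]].
  apply Rminus_diag_uniq.
  apply const0_of_linear_bound with (a * (ib * ib + ia) * L) delta; [assumption|]; intros h Hh.
  destruct (orb h Hh) as [x [Hx [Hper Hxt]]].
  destruct (mvt (fun s => (/ x s + IB s) ^ 3 / 3 + (/ x s + IB s) * IA s + IAB s)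
    (fun s => - (A s * (IB s * IB s + IA s) * x s)) 0 1)
    as [c [Hc' E]]; [lra| |].
  { intros t Ht; assert (D1 := DW x Hx t Ht (proj1 (Hxt t Ht))); assert (D2 := HIA t Ht).
    assert (D3 := HIAB t Ht).
    set (W := fun s : R => / x s + IB s); change (is_derive W t (- (A t * x t))) in D1.
    assert (EW : x t * W t = 1 + x t * IB t) by (unfold W; field; now apply Hxt).
    change (is_derive (fun s => W s ^ 3 / 3 + W s * IA s + IAB s) t
              (- (A t * (IB t * IB t + IA t) * x t))); clearbody W.
    auto_derive; [repeat split; auto; eexists; eassumption|].
    rewrite_derive D1; rewrite_derive D2; rewrite_derive D3.
    (* The first use of [EW] cancels [W * A], the second cancels [A * IB]. *)
    transitivity (- (A t * W t * (x t * W t)) - A t * x t * IA t + W t * A t + A t * IB t);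
      [field | rewrite EW].
    transitivity (- (A t * IB t * (x t * W t)) - A t * x t * IA t + A t * IB t);
      [ring | rewrite EW; ring]. }
  replace (IAB 1 - IAB 0) with (- (A c * (IB c * IB c + IA c) * x c) * (1 - 0))
    by (rewrite <- E, Hper, E1, E2, IA0, IB0; lra).
  replace (- (A c * (IB c * IB c + IA c) * x c) * (1 - 0)) with (- (A c * (IB c * IB c + IA c) * x c)) by ring.
  rewrite Rabs_Ropp, (Rmult_assoc (a * (ib * ib + ia))).
  apply Rabs_mult_le; [apply Rabs_mult_le; [apply Ha' | apply Rabs_plus_le; [apply Rabs_mult_le|]] | apply Hxt];
    try apply Hib'; try apply Hia'; lra.
Qed.

End Center.

(* Composing an autonomous solution [X] with the periodic primitive [Q] of [P] closes up every orbit. *)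
Lemma center_of_proportional (P Q : R -> R) (al be : R) :
  (forall t, 0 <= t <= 1 -> is_derive Q t (P t)) -> Q 0 = 0 -> Q 1 = 0 ->
  has_center_at_0 (fun t => al * P t) (fun t => be * P t).
Proof.
  intros HQ Q0 Q1.
  destruct (bounded_on Q 0 1) as [q [Hq Hq']].
  { intros t Ht; exact (is_derive_continuous _ _ _ (HQ t Ht)). }
  destruct (abel_cut_bounds (fun _ => al) (fun _ => be) 1) as [M [K [HK [_ HL]]]];
    [lra | intros; apply continuous_cst.. |].
  assert (HeK := exp_pos (K * q)).
  (* The cut field vanishes at 0, so [X] grows by a factor at most [exp (K * |u|)] up to time [u];
     as [|Q| <= q], this radius keeps [X (Q t)] in [-1,1], where the cut is inactive. *)
  exists (1 / exp (K * q)); split; [apply Rdiv_lt_0_compat; lra|].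
  intros x0 Hx0.
  destruct (abel_cut_solution (fun _ => al) (fun _ => be) 1) with (t0 := 0) (x0 := x0)
    as [X [X0 HX]]; [lra | intros; apply continuous_cst.. |].
  assert (small : forall t, 0 <= t <= 1 -> Rabs (X (Q t)) <= 1).
  { intros t Ht.
    apply Rle_trans with (Rabs x0 * exp (K * q)).
    2: { apply Rlt_le in Hx0; apply Rmult_le_compat_r with (r := exp (K * q)) in Hx0; [|lra].
         replace (1 / exp (K * q) * exp (K * q)) with 1 in Hx0 by (field; lra); exact Hx0. }
    apply abs_le_sqrt_exp; [apply Rabs_pos|].
    rewrite pow2_abs, <- X0.
    apply Rle_trans with (X 0 ^ 2 * exp (2 * K * Rabs (Q t - 0))).
    - apply (gronwall_two_sided (fun s => X s ^ 2)
        (fun s => 2 * X s * (abel_cut (fun _ => al) (fun _ => be) 1 s (X s)))); intros s _.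
      + assert (D := HX s); auto_derive; [eexists; eassumption|].
        rewrite_derive D; ring.
      + replace (2 * K * X s ^ 2) with (2 * Rabs (X s) * (K * Rabs (X s - 0))).
        2: { rewrite Rminus_0_r, <- pow2_abs; ring. }
        rewrite !Rabs_mult, (Rabs_pos_eq 2) by lra.
        apply Rmult_le_compat_l; [pose proof (Rabs_pos (X s)); lra |].
        apply Rle_trans with (2 := HL s (X s) 0); right; f_equal.
        unfold abel_cut at 3; rewrite (clamp_id (- (1)) 1 0) by lra; ring.
    - apply Rmult_le_compat_l; [apply pow2_ge_0|].
      specialize (Hq' t Ht); rewrite Rminus_0_r.
      destruct (Req_dec (Rabs (Q t)) q) as [-> | Hn]; [right; f_equal; ring|].
      apply Rlt_le, exp_increasing; nra. }
  exists (fun t => X (Q t)); split; [|rewrite Q0, Q1; auto].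
  intros t Ht; assert (D1 := HX (Q t)); assert (D2 := HQ t Ht).
  auto_derive; [repeat split; eexists; eassumption|].
  rewrite_derive D1; rewrite_derive D2.
  unfold abel_cut; rewrite clamp_id; [ring|].
  specialize (small t Ht); revert small; split_Rabs; lra.
Qed.

(** * Periodic orbits when a combination of the coefficients has constant sign *)

(** [d * exp (- I)] is strictly increasing, so a zero in [0,1] gives [d 0 <= 0 <= d 1] with at least
    one strict inequality, against [d 0 = d 1]. *)
Lemma linear_ode_no_zero (p q d I : R -> R) :
  (forall t, 0 <= t <= 1 -> is_derive I t (p t)) ->
  (forall t, 0 <= t <= 1 -> is_derive d t (p t * d t + q t)) ->
  (forall t, 0 < t < 1 -> 0 < q t) -> d 0 = d 1 ->
  forall t, 0 <= t <= 1 -> d t <> 0.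
Proof.
  intros HI Hd Hq Hper t Ht E.
  assert (mono : forall u v, 0 <= u -> u < v -> v <= 1 -> d u * exp (- I u) < d v * exp (- I v)).
  { intros u v Hu Huv Hv.
    destruct (mvt (fun s => d s * exp (- I s)) (fun s => q s * exp (- I s)) u v Huv) as [c [Hc Ec]].
    - intros s Hs.
      assert (D1 : is_derive d s (p s * d s + q s)) by (apply Hd; lra).
      assert (D2 : is_derive I s (p s)) by (apply HI; lra).
      auto_derive; [repeat split; eexists; eassumption|].
      rewrite_derive D1; rewrite_derive D2; ring.
    - assert (0 < q c * exp (- I c) * (v - u)); [|lra].
      repeat apply Rmult_lt_0_compat; [apply Hq; lra | apply exp_pos | lra]. }
  assert (e0 := exp_pos (- I 0)); assert (e1 := exp_pos (- I 1)).
  destruct (Req_dec t 0) as [-> | H0].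
  - specialize (mono 0 1); rewrite <- Hper, E in mono; lra.
  - assert (M0 := mono 0 t); rewrite E in M0.
    assert (d 0 < 0) by (apply Rmult_lt_reg_r with (exp (- I 0)); lra).
    destruct (Req_dec t 1) as [-> | H1]; [lra|].
    assert (M1 := mono t 1); rewrite E in M1.
    assert (0 < d 1) by (apply Rmult_lt_reg_r with (exp (- I 1)); lra).
    lra.
Qed.

(** Partial fractions, with logarithms of squares to cover both sides of [x = 0] and of [a = b x].
    For [a = 0] the integrand is [- 1 / (b x^3)]. *)
Lemma inverse_cubic_primitive (a b : R) : a <> 0 \/ b <> 0 ->
  exists F : R -> R, forall x, x <> 0 -> a - b * x <> 0 ->
    is_derive F x (1 / (x ^ 2 * (a - b * x))).
Proof.
  intros H; destruct (Req_dec a 0) as [-> | Ha].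
  - exists (fun x => 1 / (2 * b * x ^ 2)); intros x Hx Hy.
    assert (b <> 0) by lra.
    auto_derive; [|field; auto].
    repeat apply Rmult_integral_contrapositive_currified; lra.
  - exists (fun x => - (1 / (a * x)) + b / (2 * a ^ 2) * (ln (x ^ 2) - ln ((a - b * x) ^ 2))).
    intros x Hx Hy.
    assert (P1 : 0 < x * (x * 1)) by nra.
    assert (P2 : 0 < (a + - (b * x)) * ((a + - (b * x)) * 1)) by nra.
    auto_derive.
    + repeat split; auto.
    + change (a + - (b * x)) with (a - b * x); field; repeat split; auto.
Qed.

Section DefiniteCombination.

Variables (A B : R -> R) (a b : R).
Hypothesis HA : forall t, 0 <= t <= 1 -> continuous A t.
Hypothesis HB : forall t, 0 <= t <= 1 -> continuous B t.
Hypothesis Hdef : forall t, 0 < t < 1 -> 0 < a * A t + b * B t.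

Lemma definite_coefs : a <> 0 \/ b <> 0.
Proof.
  destruct (Req_dec a 0) as [-> | Ha]; [|now left].
  right; intros ->; specialize (Hdef (1 / 2)); lra.
Qed.

Lemma sol_same_sign (x : R -> R) (t : R) :
  is_sol A B x -> x 0 <> 0 -> 0 <= t <= 1 -> 0 < x t * x 0.
Proof.
  intros Hx Hn Ht.
  destruct (diff_coef_primitive A B HA HB x (fun _ => 0)) as [I HI].
  - intros u Hu; exact (is_sol_continuous A B x u Hx Hu).
  - intros; apply continuous_cst.
  - assert (E := sol_diff A B x (fun _ => 0) I Hx (is_sol_zero A B) HI t Ht).
    rewrite !Rminus_0_r in E; rewrite E.
    pose proof (exp_pos (I t - I 0)).
    replace (x 0 * exp (I t - I 0) * x 0) with (exp (I t - I 0) * (x 0 * x 0)) by ring.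
    apply Rmult_lt_0_compat; [assumption | nra].
Qed.

(* For [w = a (a - b x)] one has [w' = - (b B x^2 / a) w - b (a A + b B) x^3]: solutions cross
   the line [x = a / b] in one direction only. *)
Lemma periodic_avoids_line (x : R -> R) :
  is_sol A B x -> x 0 <> 0 -> x 0 = x 1 -> forall t, 0 <= t <= 1 -> a - b * x t <> 0.
Proof.
  intros Hx Hn Hper t Ht.
  assert (Hs : forall s, 0 <= s <= 1 -> 0 < x s * x 0) by (intros s; now apply sol_same_sign).
  assert (Hxt : x t <> 0) by (intros E; specialize (Hs t Ht); rewrite E in Hs; lra).
  destruct (Req_dec a 0) as [Ea | Ha].
  { rewrite Ea; destruct definite_coefs; [lra|].
    rewrite Rminus_0_l; apply Ropp_neq_0_compat, Rmult_integral_contrapositive_currified; auto. }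
  destruct (Req_dec b 0) as [Eb | Hb]; [rewrite Eb; lra|].
  destruct (primitive_unit (fun s => - (b / a) * (B s * x s ^ 2))) as [I HI].
  { intros s Hs'; continuity_tac; auto; exact (is_sol_continuous A B x s Hx Hs'). }
  intros E.
  (* The factor [- (b * x 0 ^ 3)] turns the source term into [b^2 (a A + b B) (x(s) x(0))^3],
     positive whatever the signs of [b] and [x]. *)
  apply (linear_ode_no_zero (fun s => - (b / a) * (B s * x s ^ 2))
    (fun s => b ^ 2 * (a * A s + b * B s) * (x s * x 0) ^ 3)
    (fun s => - (b * x 0 ^ 3) * (a * (a - b * x s))) I HI) with (t := t); auto.
  - intros s Hs'; assert (D := Hx s Hs').
    auto_derive; [eexists; eassumption|].
    rewrite_derive D; field; auto.
  - intros s Hs'; specialize (Hdef s Hs'); assert (P := Hs s ltac:(lra)).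
    apply Rmult_lt_0_compat; [apply Rmult_lt_0_compat|]; auto; [apply pow2_gt_0 | apply pow_lt]; auto.
  - now rewrite Hper.
  - rewrite E; ring.
Qed.

(* For two periodic solutions and a primitive [F] of [1 / (x^2 (a - b x))], the derivative of
   [F(x) - F(y)] is [(a A + b B) (x - y) / ((a - b x) (a - b y))], which cannot vanish on (0,1). *)
Lemma definite_periodic_unique (x y : R -> R) :
  is_sol A B x -> x 0 <> 0 -> x 0 = x 1 ->
  is_sol A B y -> y 0 <> 0 -> y 0 = y 1 -> x 0 = y 0.
Proof.
  intros Hx Hx0 Hxp Hy Hy0 Hyp.
  destruct (Req_dec (x 0) (y 0)) as [E | Hn]; [exact E | exfalso].
  destruct (inverse_cubic_primitive a b definite_coefs) as [F HF].
  assert (Hl1 := periodic_avoids_line x Hx Hx0 Hxp).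
  assert (Hl2 := periodic_avoids_line y Hy Hy0 Hyp).
  assert (Hnx : forall t, 0 <= t <= 1 -> x t <> 0).
  { intros t Ht; apply (sol_nonzero A B HA HB x 0 t Hx); lra. }
  assert (Hny : forall t, 0 <= t <= 1 -> y t <> 0).
  { intros t Ht; apply (sol_nonzero A B HA HB y 0 t Hy); lra. }
  destruct (rolle (fun t => F (x t) - F (y t))
    (fun t => (a * A t + b * B t) * (x t - y t) / ((a - b * x t) * (a - b * y t))) 0 1)
    as [c [Hc E]]; [lra | | now rewrite Hxp, Hyp |].
  - intros t Ht.
    assert (D1 := Hx t Ht); assert (D2 := Hy t Ht).
    assert (D3 := HF _ (Hnx t Ht) (Hl1 t Ht)); assert (D4 := HF _ (Hny t Ht) (Hl2 t Ht)).
    auto_derive; [repeat split; eexists; eassumption|].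
    rewrite_derive D1; rewrite_derive D2; rewrite_derive D3; rewrite_derive D4.
    field; repeat split; auto.
  - assert (Hc' : 0 <= c <= 1) by lra.
    specialize (Hdef c Hc); specialize (Hl1 c Hc'); specialize (Hl2 c Hc').
    assert (x c - y c <> 0).
    { assert (x c <> y c) by (apply (sol_neq A B HA HB x y 0 c Hx Hy); auto; lra). lra. }
    revert E; unfold Rdiv; apply Rmult_integral_contrapositive_currified.
    + apply Rmult_integral_contrapositive_currified; [lra | assumption].
    + apply Rinv_neq_0_compat, Rmult_integral_contrapositive_currified; assumption.
Qed.

(** Multiplier 1 would give [J], hence [J - ln |a - b x|], equal values at 0 and 1; but the
    derivative [(a A + b B) x^2 / (a - b x)] has no zero on (0,1). *)
Lemma definite_periodic_hyperbolic (x : R -> R) :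
  is_sol A B x -> x 0 <> 0 -> x 0 = x 1 -> hyperbolic A B (x 0).
Proof.
  intros Hx Hx0 Hxp.
  assert (Hl := periodic_avoids_line x Hx Hx0 Hxp).
  destruct (primitive_unit (fun t => A t * x t ^ 2)) as [J HJ].
  { intros s Hs; continuity_tac; auto; exact (is_sol_continuous A B x s Hx Hs). }
  apply (hyperbolic_of_multiplier A B HA HB x J Hx Hx0 Hxp HJ); intros EJ.
  destruct (rolle (fun t => J t - ln ((a - b * x t) ^ 2) / 2)
    (fun t => (a * A t + b * B t) * x t ^ 2 / (a - b * x t)) 0 1)
    as [c [Hc E]]; [lra | | now rewrite EJ, Hxp |].
  - intros t Ht.
    assert (D0 := Hx t Ht).
    assert (D1 : is_derive (fun s => a - b * x s) t (- b * (A t * x t ^ 3 + B t * x t ^ 2))).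
    { auto_derive; [eexists; eassumption | rewrite_derive D0; ring]. }
    assert (D2 := is_derive_ln_sqr _ _ _ D1 (Hl t Ht)); cbv beta in D2.
    assert (D3 := HJ t Ht).
    set (g := fun s : R => ln ((a - b * x s) ^ 2)) in *.
    change (is_derive (fun s => J s - g s / 2) t ((a * A t + b * B t) * x t ^ 2 / (a - b * x t))).
    change (is_derive g t (2 * (- b * (A t * x t ^ 3 + B t * x t ^ 2)) / (a - b * x t))) in D2.
    clearbody g.
    auto_derive; [repeat split; eexists; eassumption|].
    rewrite_derive D2; rewrite_derive D3; field; now apply Hl.
  - assert (Hc' : 0 <= c <= 1) by lra.
    specialize (Hdef c Hc); specialize (Hl c Hc').
    assert (x c <> 0) by (apply (sol_nonzero A B HA HB x 0 c Hx); lra).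
    revert E; unfold Rdiv; apply Rmult_integral_contrapositive_currified.
    + apply Rmult_integral_contrapositive_currified; [lra | now apply pow_nonzero].
    + now apply Rinv_neq_0_compat.
Qed.

End DefiniteCombination.

(** * Periodic orbits when the coefficients are proportional *)

Section Proportional.

Variables (P Q : R -> R) (al be : R).
Hypothesis HP : forall t, 0 <= t <= 1 -> continuous P t.
Hypothesis HQ : forall t, 0 <= t <= 1 -> is_derive Q t (P t).
Hypothesis HQ01 : Q 0 <> Q 1.
Hypothesis Hab : al <> 0 \/ be <> 0.

Let A (t : R) : R := al * P t.
Let B (t : R) : R := be * P t.

Lemma proportional_continuous (c t : R) : 0 <= t <= 1 -> continuous (fun s => c * P s) t.
Proof. intros Ht; continuity_tac; auto. Qed.

(** [be + al * x] solves a homogeneous linear equation, so it vanishes everywhere or nowhere. In the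
    second case separation of variables makes [F(x) - Q] constant, and periodicity forces
    [Q 0 = Q 1]. *)
Lemma proportional_periodic_constant (x : R -> R) :
  is_sol A B x -> x 0 <> 0 -> x 0 = x 1 -> forall t, 0 <= t <= 1 -> be + al * x t = 0.
Proof.
  intros Hx Hx0 Hxp.
  assert (Hnx : forall t, 0 <= t <= 1 -> x t <> 0).
  { intros t Ht; apply (sol_nonzero A B (proportional_continuous al) (proportional_continuous be) x 0 t Hx); lra. }
  destruct (primitive_unit (fun t => al * P t * x t ^ 2)) as [I HI].
  { intros s Hs; continuity_tac; auto; exact (is_sol_continuous A B x s Hx Hs). }
  assert (Ey := linear_ode (fun t => al * P t * x t ^ 2) (fun t => be + al * x t) I HI); cbv beta in Ey.
  assert (Ey' : forall t, 0 <= t <= 1 -> be + al * x t = (be + al * x 0) * exp (I t - I 0)).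
  { apply Ey; intros t Ht; assert (D := Hx t Ht).
    auto_derive; [eexists; eassumption | rewrite_derive D; unfold A, B; ring]. }
  destruct (Req_dec (be + al * x 0) 0) as [E0 | Hn].
  { intros t Ht; rewrite Ey', E0 by assumption; ring. }
  exfalso.
  destruct (inverse_cubic_primitive be (- al)) as [F HF].
  { destruct Hab; [right; lra | now left]. }
  destruct (mvt (fun t => F (x t) - Q t) (fun _ => 0) 0 1) as [c [_ E]]; [lra | |].
  - intros t Ht.
    assert (Hl : be - - al * x t <> 0).
    { replace (be - - al * x t) with (be + al * x t) by ring; rewrite Ey' by assumption.
      apply Rmult_integral_contrapositive_currified; [assumption|].
      pose proof (exp_pos (I t - I 0)); lra. }
    assert (D1 := Hx t Ht); assert (D2 := HQ t Ht).
    assert (D3 := HF _ (Hnx t Ht) Hl).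
    auto_derive; [repeat split; eexists; eassumption|].
    rewrite_derive D1; rewrite_derive D2; rewrite_derive D3; unfold A, B.
    field; split; auto.
  - apply HQ01; rewrite Hxp in E; lra.
Qed.

Lemma proportional_periodic_unique (x y : R -> R) :
  is_sol A B x -> x 0 <> 0 -> x 0 = x 1 ->
  is_sol A B y -> y 0 <> 0 -> y 0 = y 1 -> x 0 = y 0.
Proof.
  intros Hx Hx0 Hxp Hy Hy0 Hyp.
  assert (E1 := proportional_periodic_constant x Hx Hx0 Hxp 0 ltac:(lra)).
  assert (E2 := proportional_periodic_constant y Hy Hy0 Hyp 0 ltac:(lra)).
  destruct (Req_dec al 0) as [E | Hn].
  - rewrite E in E1; destruct Hab; lra.
  - apply Rmult_eq_reg_l with al; lra.
Qed.

(** The orbit is constant, so the logarithm of its multiplier is [al * x 0 ^ 2 * (Q 1 - Q 0)]. *)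
Lemma proportional_periodic_hyperbolic (x : R -> R) :
  is_sol A B x -> x 0 <> 0 -> x 0 = x 1 -> hyperbolic A B (x 0).
Proof.
  intros Hx Hx0 Hxp.
  assert (Hc := proportional_periodic_constant x Hx Hx0 Hxp).
  assert (Hal : al <> 0).
  { intros E; specialize (Hc 0 ltac:(lra)); rewrite E in Hc; destruct Hab; lra. }
  assert (Ex : forall t, 0 <= t <= 1 -> x t = x 0).
  { intros t Ht; apply Rmult_eq_reg_l with al; [|assumption].
    assert (H1 := Hc t Ht); assert (H2 := Hc 0 ltac:(lra)); lra. }
  apply (hyperbolic_of_multiplier A B (proportional_continuous al) (proportional_continuous be)
    x (fun t => al * x 0 ^ 2 * Q t) Hx Hx0 Hxp).
  - intros t Ht; assert (D := HQ t Ht).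
    auto_derive; [eexists; eassumption|].
    rewrite_derive D; unfold A; rewrite (Ex t Ht); ring.
  - intros E; apply HQ01; apply Rmult_eq_reg_l with (al * x 0 ^ 2); [exact E|].
    apply Rmult_integral_contrapositive_currified; [assumption | now apply pow_nonzero].
Qed.

End Proportional.

(** * Trinomial coefficients *)

Lemma continuous_var (t : R) : continuous (fun s : R => s) t.
Proof. exact (continuous_id t). Qed.

Lemma trinom_continuous (c0 c1 c2 : R) (j k : nat) (t : R) :
  continuous (trinom c0 c1 c2 j k) t.
Proof. unfold trinom; continuity_tac; apply continuous_var. Qed.

Definition mono_primitive (c : R) (n : nat) (t : R) : R := c * t ^ S n / INR (S n).

Lemma is_derive_mono (c : R) (n : nat) (t : R) : is_derive (mono_primitive c n) t (c * t ^ n).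
Proof.
  assert (INR (S n) <> 0) by (apply not_0_INR; lia).
  unfold mono_primitive; auto_derive; [trivial|].
  change (pred (S n)) with n; field; assumption.
Qed.

Lemma mono_primitive_0 (c : R) (n : nat) : mono_primitive c n 0 = 0.
Proof. unfold mono_primitive, Rdiv; rewrite pow_i by lia; ring. Qed.

Lemma mono_primitive_1 (c : R) (n : nat) : mono_primitive c n 1 = c / INR (S n).
Proof. unfold mono_primitive; rewrite pow1, Rmult_1_r; reflexivity. Qed.

Lemma is_derive_add (f g : R -> R) (t l m : R) :
  is_derive f t l -> is_derive g t m -> is_derive (fun s => f s + g s) t (l + m).
Proof. exact (is_derive_plus f g t l m). Qed.

Lemma is_derive_eq (f : R -> R) (t l m : R) : is_derive f t l -> l = m -> is_derive f t m.
Proof. intros H E; now rewrite <- E. Qed.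

Definition trinom_primitive (c0 c1 c2 : R) (j k : nat) (t : R) : R :=
  mono_primitive c0 0 t + mono_primitive c1 j t + mono_primitive c2 k t.

Lemma is_derive_trinom (c0 c1 c2 : R) (j k : nat) (t : R) :
  is_derive (trinom_primitive c0 c1 c2 j k) t (trinom c0 c1 c2 j k t).
Proof.
  unfold trinom_primitive, trinom.
  replace (c0 + c1 * t ^ j + c2 * t ^ k) with (c0 * t ^ 0 + c1 * t ^ j + c2 * t ^ k)
    by (simpl; ring).
  repeat apply is_derive_add; apply is_derive_mono.
Qed.

Lemma trinom_primitive_0 (c0 c1 c2 : R) (j k : nat) : trinom_primitive c0 c1 c2 j k 0 = 0.
Proof. unfold trinom_primitive; rewrite !mono_primitive_0; ring. Qed.

Lemma trinom_primitive_1 (c0 c1 c2 : R) (j k : nat) :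
  trinom_primitive c0 c1 c2 j k 1 = c0 + c1 / INR (j + 1) + c2 / INR (k + 1).
Proof.
  unfold trinom_primitive; rewrite !mono_primitive_1, !Nat.add_1_r; simpl (INR 1).
  unfold Rdiv at 1; rewrite Rinv_1; ring.
Qed.

(** Primitive of [A] times the primitive of [B], expanded over the nine pairs of monomials: the
    [IAB] of [center_integrals] for trinomials. *)
Definition mixed_primitive (a0 a1 a2 b0 b1 b2 : R) (j k : nat) (t : R) : R :=
  mono_primitive (a0 * b0) 1 t
  + mono_primitive (a1 * b0) (j + 1) t
  + mono_primitive (a2 * b0) (k + 1) t
  + mono_primitive (a0 * (b1 / INR (S j))) (j + 1) t
  + mono_primitive (a1 * (b1 / INR (S j))) (j + j + 1) t
  + mono_primitive (a2 * (b1 / INR (S j))) (k + j + 1) t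
  + mono_primitive (a0 * (b2 / INR (S k))) (k + 1) t
  + mono_primitive (a1 * (b2 / INR (S k))) (j + k + 1) t
  + mono_primitive (a2 * (b2 / INR (S k))) (k + k + 1) t.

Lemma is_derive_mixed (a0 a1 a2 b0 b1 b2 : R) (j k : nat) (t : R) :
  is_derive (mixed_primitive a0 a1 a2 b0 b1 b2 j k) t
    (trinom a0 a1 a2 j k t * trinom_primitive b0 b1 b2 j k t).
Proof.
  eapply is_derive_eq.
  { unfold mixed_primitive; do 8 (eapply is_derive_add; [|apply is_derive_mono]); apply is_derive_mono. }
  unfold trinom, trinom_primitive, mono_primitive; rewrite !pow_add; simpl (INR 1).
  simpl (t ^ S j); simpl (t ^ S k); simpl (t ^ 1).
  assert (INR (S j) <> 0) by (apply not_0_INR; lia).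
  assert (INR (S k) <> 0) by (apply not_0_INR; lia).
  field; auto.
Qed.

(* After eliminating [a0] and [b0] by the vanishing of the two means, [int A (int B)] is an
   antisymmetric form in [(a1, a2), (b1, b2)]; its coefficient vanishes only if [j = k]. *)
Lemma mixed_integral_vanishes (a0 a1 a2 b0 b1 b2 : R) (j k : nat) :
  (0 < j < k)%nat ->
  a0 + a1 / INR (j + 1) + a2 / INR (k + 1) = 0 ->
  b0 + b1 / INR (j + 1) + b2 / INR (k + 1) = 0 ->
  mixed_primitive a0 a1 a2 b0 b1 b2 j k 1 = 0 -> a2 * b1 - a1 * b2 = 0.
Proof.
  intros [Hj Hjk] EA EB E.
  assert (HJ : 0 < INR j) by (apply lt_0_INR; lia).
  assert (HK : INR j < INR k) by (apply lt_INR; lia).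
  revert E; unfold mixed_primitive; rewrite !mono_primitive_1.
  revert EA EB; rewrite ?S_INR, ?plus_INR, ?S_INR, ?plus_INR, INR_0, !Rplus_0_l.
  generalize dependent (INR k); generalize dependent (INR j); intros J HJ K HK EA EB.
  replace a0 with (- (a1 / (J + 1)) - a2 / (K + 1)) by lra.
  replace b0 with (- (b1 / (J + 1)) - b2 / (K + 1)) by lra.
  intros E.
  match type of E with ?l = 0 => replace l with
    ((a2 * b1 - a1 * b2) * (K * J * (K - J) / (2 * (K + 1) * (J + 1) * (K + 2) * (J + 2) * (J + K + 2)))) in E
    by (field; repeat split; lra) end.
  destruct (Rmult_integral _ _ E) as [E' | E']; [exact E' | exfalso].
  assert (0 < K * J * (K - J) / (2 * (K + 1) * (J + 1) * (K + 2) * (J + 2) * (J + K + 2))); [|lra].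
  apply Rdiv_lt_0_compat; repeat apply Rmult_lt_0_compat; lra.
Qed.

(** Vanishing minors mean rank at most one. A nonzero entry of the first triple serves as pivot; if
    there is none, the second triple is taken with factors 0 and 1. *)
Lemma proportional_triples (a0 a1 a2 b0 b1 b2 : R) :
  a1 * b0 - a0 * b1 = 0 -> a2 * b0 - a0 * b2 = 0 -> a2 * b1 - a1 * b2 = 0 ->
  exists p0 p1 p2 al be, (a0 = al * p0 /\ a1 = al * p1 /\ a2 = al * p2) /\
    (b0 = be * p0 /\ b1 = be * p1 /\ b2 = be * p2).
Proof.
  intros H1 H2 H3.
  destruct (Req_dec a0 0) as [E0 | N0].
  2: { exists a0, a1, a2, 1, (b0 / a0); repeat split; try (field; assumption); try ring;
       apply Rmult_eq_reg_l with a0; auto; field_simplify; auto; lra. }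
  destruct (Req_dec a1 0) as [E1 | N1].
  2: { exists a0, a1, a2, 1, (b1 / a1); repeat split; try (field; assumption); try ring;
       apply Rmult_eq_reg_l with a1; auto; field_simplify; auto; lra. }
  destruct (Req_dec a2 0) as [E2 | N2].
  2: { exists a0, a1, a2, 1, (b2 / a2); repeat split; try (field; assumption); try ring;
       apply Rmult_eq_reg_l with a2; auto; field_simplify; auto; lra. }
  exists b0, b1, b2, 0, 1; repeat split; lra.
Qed.

Lemma trinom_scal (c p0 p1 p2 : R) (j k : nat) :
  trinom (c * p0) (c * p1) (c * p2) j k = (fun t => c * trinom p0 p1 p2 j k t).
Proof.
  apply functional_extensionality; intros t; unfold trinom; ring.
Qed.

(** Necessity is [center_integrals] on explicit primitives. For sufficiency, the zero means make the
    other two minors multiples of [a2 * b1 - a1 * b2], so both coefficients are multiples of one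
    trinomial. *)
Lemma center_iff (j k : nat) (a0 a1 a2 b0 b1 b2 : R) :
  (0 < j < k)%nat ->
  (has_center_at_0 (trinom a0 a1 a2 j k) (trinom b0 b1 b2 j k) <->
   (a0 + a1 / INR (j + 1) + a2 / INR (k + 1) = 0 /\
    b0 + b1 / INR (j + 1) + b2 / INR (k + 1) = 0 /\
    a2 * b1 - a1 * b2 = 0)).
Proof.
  intros Hjk; split.
  - intros Hc.
    destruct (center_integrals (trinom a0 a1 a2 j k) (trinom b0 b1 b2 j k)
      (trinom_primitive a0 a1 a2 j k) (trinom_primitive b0 b1 b2 j k)
      (mixed_primitive a0 a1 a2 b0 b1 b2 j k)) as [EB [EA EAB]]; try exact Hc;
      try (intros t _; (apply trinom_continuous || apply is_derive_trinom || apply is_derive_mixed));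
      try apply trinom_primitive_0.
    rewrite trinom_primitive_1 in EA, EB.
    split; [exact EA | split; [exact EB|]].
    apply (mixed_integral_vanishes a0 a1 a2 b0 b1 b2 j k Hjk EA EB).
    rewrite EAB; unfold mixed_primitive; rewrite !mono_primitive_0; ring.
  - intros [EA [EB EM]].
    assert (HJ : INR (j + 1) <> 0) by (apply not_0_INR; lia).
    assert (HK : INR (k + 1) <> 0) by (apply not_0_INR; lia).
    assert (Ea : a0 = - (a1 / INR (j + 1)) - a2 / INR (k + 1)) by lra.
    assert (Eb : b0 = - (b1 / INR (j + 1)) - b2 / INR (k + 1)) by lra.
    assert (E10 : a1 * b0 - a0 * b1 = 0).
    { rewrite Ea, Eb.
      transitivity ((a2 * b1 - a1 * b2) / INR (k + 1)); [field; auto | rewrite EM; field; auto]. }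
    assert (E20 : a2 * b0 - a0 * b2 = 0).
    { rewrite Ea, Eb.
      transitivity (- (a2 * b1 - a1 * b2) / INR (j + 1)); [field; auto | rewrite EM; field; auto]. }
    (* The case [A = 0] is treated apart, with [P = B]; otherwise [al <> 0] and the zero mean of [P]
       follows from that of [A]. *)
    destruct (Req_dec a0 0) as [Za0 | Za0]; [destruct (Req_dec a1 0) as [Za1 | Za1];
      [destruct (Req_dec a2 0) as [Za2 | Za2]|]|].
    1: { assert (X := center_of_proportional (trinom b0 b1 b2 j k) (trinom_primitive b0 b1 b2 j k) 0 1
           (fun t _ => is_derive_trinom _ _ _ _ _ t) (trinom_primitive_0 _ _ _ _ _)
           (eq_trans (trinom_primitive_1 _ _ _ _ _) EB)).
         rewrite <- !trinom_scal, !Rmult_0_l, !Rmult_1_l in X; subst a1 a2; rewrite Za0; exact X. }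
    all: destruct (proportional_triples a0 a1 a2 b0 b1 b2 E10 E20 EM)
      as [p0 [p1 [p2 [al [be [[Ha0 [Ha1 Ha2]] [Hb0 [Hb1 Hb2]]]]]]]].
    all: assert (Hal : al <> 0) by (intros Z; rewrite Z, Rmult_0_l in Ha0, Ha1, Ha2; contradiction).
    all: assert (EP : p0 + p1 / INR (j + 1) + p2 / INR (k + 1) = 0)
      by (apply Rmult_eq_reg_l with al; [|exact Hal];
          rewrite Rmult_0_r, <- EA, Ha0, Ha1, Ha2; field; auto).
    all: rewrite Ha0, Ha1, Ha2, Hb0, Hb1, Hb2, !trinom_scal.
    all: apply (center_of_proportional (trinom p0 p1 p2 j k) (trinom_primitive p0 p1 p2 j k) al be
           (fun t _ => is_derive_trinom _ _ _ _ _ t) (trinom_primitive_0 _ _ _ _ _)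
           (eq_trans (trinom_primitive_1 _ _ _ _ _) EP)).
Qed.

(** * Uniqueness and hyperbolicity for trinomial coefficients *)

Definition orbits_unique (A B : R -> R) : Prop :=
  (forall x0 y0, x0 <> 0 -> y0 <> 0 -> periodic_orbit A B x0 -> periodic_orbit A B y0 -> x0 = y0) /\
  (forall x0, x0 <> 0 -> periodic_orbit A B x0 -> hyperbolic A B x0).

Lemma orbits_unique_intro (A B : R -> R) :
  (forall x y, is_sol A B x -> x 0 <> 0 -> x 0 = x 1 ->
               is_sol A B y -> y 0 <> 0 -> y 0 = y 1 -> x 0 = y 0) ->
  (forall x, is_sol A B x -> x 0 <> 0 -> x 0 = x 1 -> hyperbolic A B (x 0)) ->
  orbits_unique A B.
Proof.
  intros H1 H2; split.
  - intros x0 y0 Hx0 Hy0 [x [Hx [Ex0 Ex1]]] [y [Hy [Ey0 Ey1]]].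
    rewrite <- Ex0, <- Ey0; apply H1; auto; congruence.
  - intros x0 Hx0 [x [Hx [Ex0 Ex1]]].
    rewrite <- Ex0; apply H2; auto; congruence.
Qed.

Lemma orbits_unique_of_combination (A B : R -> R) (a b : R) :
  (forall t, 0 <= t <= 1 -> continuous A t) -> (forall t, 0 <= t <= 1 -> continuous B t) ->
  (forall t, 0 < t < 1 -> 0 < a * A t + b * B t) \/
  (forall t, 0 < t < 1 -> a * A t + b * B t < 0) ->
  orbits_unique A B.
Proof.
  intros HA HB [H | H].
  - apply orbits_unique_intro.
    + intros x y; apply (definite_periodic_unique A B a b HA HB H).
    + intros x; apply (definite_periodic_hyperbolic A B a b HA HB H).
  - assert (H' : forall t, 0 < t < 1 -> 0 < - a * A t + - b * B t)
      by (intros t Ht; specialize (H t Ht); lra).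
    apply orbits_unique_intro.
    + intros x y; apply (definite_periodic_unique A B (- a) (- b) HA HB H').
    + intros x; apply (definite_periodic_hyperbolic A B (- a) (- b) HA HB H').
Qed.

Lemma pow_unit_interval (t : R) (n : nat) : (0 < n)%nat -> 0 < t < 1 -> 0 < t ^ n < 1.
Proof.
  intros Hn Ht; split; [apply pow_lt; lra|].
  destruct n as [|n]; [lia|].
  assert (0 < t ^ n) by (apply pow_lt; lra).
  assert (t ^ n <= 1) by (rewrite <- (pow1 n); apply pow_incr; lra).
  simpl; nra.
Qed.

(** For [d <> 0] the binomial is [d] times [n / d + t ^ m] with [t ^ m] in (0,1), and [cond_ratio]
    excludes a zero there. *)
Lemma binomial_definite (n d : R) (m : nat) :
  (0 < m)%nat -> cond_ratio n d -> n <> 0 \/ d <> 0 ->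
  (forall t, 0 < t < 1 -> 0 < n + d * t ^ m) \/ (forall t, 0 < t < 1 -> n + d * t ^ m < 0).
Proof.
  intros Hm Hr Hnd.
  destruct (Req_dec d 0) as [Hd | Hd].
  { destruct Hnd as [Hn | Hn]; [|contradiction]; rewrite Hd.
    destruct (Rlt_le_dec 0 n); [left | right]; intros; lra. }
  destruct Hr as [Hr | Hr]; [contradiction|].
  assert (En : n = n / d * d) by (field; assumption).
  set (r := n / d) in *; clearbody r; subst n.
  assert (Hr' : r <= -1 \/ 0 <= r) by lra.
  assert (key : forall t, 0 < t < 1 -> 0 < t ^ m < 1) by (intros t; now apply pow_unit_interval).
  destruct Hr' as [H1 | H1]; destruct (Rlt_le_dec 0 d).
  - right; intros t Ht; specialize (key t Ht); nra.
  - left; intros t Ht; specialize (key t Ht); nra.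
  - left; intros t Ht; specialize (key t Ht); nra.
  - right; intros t Ht; specialize (key t Ht); nra.
Qed.

(* Each condition says that the combination of [A] and [B] eliminating one of the three monomials
   has constant sign on (0,1); when that combination is zero but [A], [B] are not proportional,
   another combination is a nonzero constant or monomial. *)
Lemma trinomial_orbits_unique (j k : nat) (a0 a1 a2 b0 b1 b2 : R) :
  (0 < j < k)%nat ->
  ~ has_center_at_0 (trinom a0 a1 a2 j k) (trinom b0 b1 b2 j k) ->
  (cond_ratio (a2 * b0 - a0 * b2) (a2 * b1 - a1 * b2) \/
   cond_ratio (a1 * b0 - a0 * b1) (a1 * b2 - a2 * b1) \/
   cond_ratio (a0 * b1 - a1 * b0) (a0 * b2 - a2 * b0)) ->
  orbits_unique (trinom a0 a1 a2 j k) (trinom b0 b1 b2 j k).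
Proof.
  intros Hjk Hnc Hcond.
  assert (CA := fun (t : R) (_ : 0 <= t <= 1) => trinom_continuous a0 a1 a2 j k t).
  assert (CB := fun (t : R) (_ : 0 <= t <= 1) => trinom_continuous b0 b1 b2 j k t).
  (* [a2 B - b2 A] has no [t^k] term: it equals [(a2 b0 - a0 b2) + (a2 b1 - a1 b2) t^j], the
     binomial of the first condition. *)
  assert (elim_k : cond_ratio (a2 * b0 - a0 * b2) (a2 * b1 - a1 * b2) ->
            a2 * b0 - a0 * b2 <> 0 \/ a2 * b1 - a1 * b2 <> 0 ->
            orbits_unique (trinom a0 a1 a2 j k) (trinom b0 b1 b2 j k)).
  { intros Hr Hn; apply orbits_unique_of_combination with (- b2) a2; auto.
    destruct (binomial_definite _ _ j ltac:(lia) Hr Hn) as [H | H]; [left | right];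
      intros t Ht; specialize (H t Ht); unfold trinom;
      match goal with |- ?u < ?v => match type of H with ?u' < ?v' =>
        replace u with u' by ring; replace v with v' by ring end end; exact H. }
  assert (elim_j : cond_ratio (a1 * b0 - a0 * b1) (a1 * b2 - a2 * b1) ->
            a1 * b0 - a0 * b1 <> 0 \/ a1 * b2 - a2 * b1 <> 0 ->
            orbits_unique (trinom a0 a1 a2 j k) (trinom b0 b1 b2 j k)).
  { intros Hr Hn; apply orbits_unique_of_combination with (- b1) a1; auto.
    destruct (binomial_definite _ _ k ltac:(lia) Hr Hn) as [H | H]; [left | right];
      intros t Ht; specialize (H t Ht); unfold trinom;
      match goal with |- ?u < ?v => match type of H with ?u' < ?v' =>
        replace u with u' by ring; replace v with v' by ring end end; exact H. }
  (* Without constant term, the combination is [t^j] times a binomial in [t^(k - j)]. *)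
  assert (elim_0 : cond_ratio (a0 * b1 - a1 * b0) (a0 * b2 - a2 * b0) ->
            a0 * b1 - a1 * b0 <> 0 \/ a0 * b2 - a2 * b0 <> 0 ->
            orbits_unique (trinom a0 a1 a2 j k) (trinom b0 b1 b2 j k)).
  { intros Hr Hn; apply orbits_unique_of_combination with (- b0) a0; auto.
    assert (E : forall t, - b0 * trinom a0 a1 a2 j k t + a0 * trinom b0 b1 b2 j k t =
      t ^ j * ((a0 * b1 - a1 * b0) + (a0 * b2 - a2 * b0) * t ^ (k - j))).
    { intros t; unfold trinom; replace k with (j + (k - j))%nat at 1 2 by lia.
      rewrite pow_add; ring. }
    destruct (binomial_definite _ _ (k - j) ltac:(lia) Hr Hn) as [H | H]; [left | right];
      intros t Ht; specialize (H t Ht); rewrite E;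
      assert (0 < t ^ j) by (apply pow_lt; lra); nra. }
  destruct (Req_dec (a1 * b0 - a0 * b1) 0) as [E10 | N10].
  2: { destruct Hcond as [H | [H | H]].
       (* If this minor vanishes, the combination without [t^k] may be zero; the one without [t^j]
          is then the nonzero constant [a1 b0 - a0 b1]. *)
       - destruct (Req_dec (a2 * b1 - a1 * b2) 0); [|apply elim_k; auto].
         apply elim_j; [left; lra | now left].
       - apply elim_j; auto.
       - apply elim_0; [exact H | left; lra]. }
  destruct (Req_dec (a2 * b0 - a0 * b2) 0) as [E20 | N20].
  2: { destruct Hcond as [H | [H | H]].
       - apply elim_k; auto.
       - destruct (Req_dec (a2 * b1 - a1 * b2) 0); [|apply elim_j; [exact H | right; lra]].
         apply elim_k; [now left | now left].
       - apply elim_0; [exact H | right; lra]. }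
  destruct (Req_dec (a2 * b1 - a1 * b2) 0) as [E21 | N21].
  2: { apply elim_k; [|now right].
       right; rewrite E20; unfold Rdiv; rewrite Rmult_0_l; lra. }
  (* All minors vanish, so both coefficients are multiples of one trinomial; the absence of a center
     makes its mean and at least one factor nonzero. *)
  destruct (proportional_triples a0 a1 a2 b0 b1 b2 E10 E20 E21)
    as [p0 [p1 [p2 [al [be [[Ha0 [Ha1 Ha2]] [Hb0 [Hb1 Hb2]]]]]]]].
  rewrite (center_iff j k a0 a1 a2 b0 b1 b2 Hjk) in Hnc.
  rewrite Ha0, Ha1, Ha2, Hb0, Hb1, Hb2, !trinom_scal.
  assert (HP := fun (t : R) (_ : 0 <= t <= 1) => trinom_continuous p0 p1 p2 j k t).
  assert (HQ := fun (t : R) (_ : 0 <= t <= 1) => is_derive_trinom p0 p1 p2 j k t).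
  assert (scal : forall c, c * p0 + c * p1 / INR (j + 1) + c * p2 / INR (k + 1) =
            c * (p0 + p1 / INR (j + 1) + p2 / INR (k + 1))) by (intros; unfold Rdiv; ring).
  assert (HQ01 : trinom_primitive p0 p1 p2 j k 0 <> trinom_primitive p0 p1 p2 j k 1).
  { rewrite trinom_primitive_0, trinom_primitive_1; intros E; apply Hnc.
    rewrite Ha0, Ha1, Ha2, Hb0, Hb1, Hb2, !scal, <- E; repeat split; ring. }
  assert (Hab : al <> 0 \/ be <> 0).
  { destruct (Req_dec al 0) as [Za|]; [|now left].
    destruct (Req_dec be 0) as [Zb|]; [|now right].
    exfalso; apply Hnc.
    rewrite Ha0, Ha1, Ha2, Hb0, Hb1, Hb2, !scal, Za, Zb; repeat split; ring. }
  apply orbits_unique_intro.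
  - exact (proportional_periodic_unique _ _ al be HP HQ HQ01 Hab).
  - exact (proportional_periodic_hyperbolic _ _ al be HP HQ HQ01 Hab).
Qed.

(** * A reversible family with two hyperbolic orbits *)

(** The names refer to parity about [t = 1 / 2], which is what makes the equation reversible. *)
Definition odd_coef (t : R) : R := t - 1 / 2.
Definition even_coef (c t : R) : R := t ^ 2 - t + c.

Lemma odd_coef_continuous (t : R) : continuous odd_coef t.
Proof.
  apply is_derive_continuous with 1; unfold odd_coef; auto_derive; [trivial | ring].
Qed.

Lemma even_coef_continuous (c t : R) : continuous (even_coef c) t.
Proof.
  apply is_derive_continuous with (2 * t - 1); unfold even_coef; auto_derive; [trivial | ring].
Qed.

Lemma is_derive_reflect (f : R -> R) (t l : R) :
  is_derive f (1 - t) l -> is_derive (fun s => f (1 - s)) t (- l).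
Proof.
  intros D; auto_derive; [now exists l|].
  change (1 + - t) with (1 - t); rewrite_derive D; ring.
Qed.

Lemma is_sol_reverse (c : R) (x : R -> R) :
  is_sol odd_coef (even_coef c) x -> is_sol odd_coef (even_coef c) (fun t => - x (1 - t)).
Proof.
  intros Hx t Ht; assert (D := is_derive_reflect x t _ (Hx (1 - t) ltac:(lra))).
  replace (odd_coef t * (- x (1 - t)) ^ 3 + even_coef c t * (- x (1 - t)) ^ 2)
    with (opp (- (odd_coef (1 - t) * x (1 - t) ^ 3 + even_coef c (1 - t) * x (1 - t) ^ 2)))
    by (unfold opp, odd_coef, even_coef; simpl; field).
  exact (is_derive_opp (fun s => x (1 - s)) t _ D).
Qed.

Definition asymmetry (x : R -> R) (t : R) : R := x t - x (1 - t).

(** Linear coefficient in the equation of [u = asymmetry x], namely [u' = asymmetry_coef u +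
    even_coef (x(t)^2 + x(1-t)^2)]. *)
Definition asymmetry_coef (c : R) (x : R -> R) (t : R) : R :=
  odd_coef t * (x t ^ 2 + x t * x (1 - t) + x (1 - t) ^ 2).

(** An integrating factor removes the linear term: [z] has the sign of the asymmetry, and its
    derivative has the sign of [even_coef]. *)
Lemma asymmetry_scaled (c : R) (x : R -> R) :
  is_sol odd_coef (even_coef c) x -> x 0 <> 0 ->
  exists z w : R -> R,
    (forall t, 0 <= t <= 1 -> is_derive z t (even_coef c t * w t)) /\
    (forall t, 0 <= t <= 1 -> 0 < w t) /\
    (forall t, 0 <= t <= 1 -> exists m, 0 < m /\ asymmetry x t = m * z t).
Proof.
  intros Hx Hx0.
  assert (Hnx : forall t, 0 <= t <= 1 -> x t <> 0).
  { intros t Ht; apply (sol_nonzero odd_coef (even_coef c)) with (x := x) (s := 0); auto; try lra;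
      intros; [apply odd_coef_continuous | apply even_coef_continuous]. }
  assert (Dr : forall t, 0 <= t <= 1 -> is_derive (fun s => x (1 - s)) t
     (- (odd_coef (1 - t) * x (1 - t) ^ 3 + even_coef c (1 - t) * x (1 - t) ^ 2))).
  { intros t Ht; apply is_derive_reflect, Hx; lra. }
  destruct (primitive_unit (asymmetry_coef c x)) as [I HI].
  { intros t Ht; unfold asymmetry_coef; continuity_tac; try apply continuous_var;
      try exact (is_derive_continuous _ _ _ (Dr t Ht)); exact (is_sol_continuous _ _ x t Hx Ht). }
  exists (fun t => asymmetry x t * exp (- I t)),
    (fun t => (x t ^ 2 + x (1 - t) ^ 2) * exp (- I t)).
  split; [|split].
  - intros t Ht; assert (D1 := Hx t Ht); assert (D2 := Dr t Ht); assert (D3 := HI t Ht).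
    unfold asymmetry; set (r := fun s : R => x (1 - s)) in *.
    change (is_derive r t (- (odd_coef (1 - t) * r t ^ 3 + even_coef c (1 - t) * r t ^ 2))) in D2.
    change (is_derive I t (odd_coef t * (x t ^ 2 + x t * r t + r t ^ 2))) in D3.
    change (is_derive (fun s => (x s - r s) * exp (- I s)) t
      (even_coef c t * ((x t ^ 2 + r t ^ 2) * exp (- I t)))).
    clearbody r.
    auto_derive; [repeat split; eexists; eassumption|].
    rewrite_derive D1; rewrite_derive D2; rewrite_derive D3.
    unfold odd_coef, even_coef; field.
  - intros t Ht; apply Rmult_lt_0_compat; [|apply exp_pos].
    assert (0 < x t ^ 2) by (apply pow2_gt_0; auto).
    assert (0 <= x (1 - t) ^ 2) by apply pow2_ge_0; lra.
  - intros t Ht; exists (exp (I t)); split; [apply exp_pos|].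
    rewrite (Rmult_comm (exp (I t))), Rmult_assoc, <- exp_plus, Rplus_opp_l, exp_0; ring.
Qed.

(** The asymmetry vanishes at 1/2, so its value at 1 takes the sign of [even_coef c] on (1/2,1). *)
Lemma asymmetry_sign (c sg : R) (x : R -> R) :
  is_sol odd_coef (even_coef c) x -> x 0 <> 0 ->
  (forall t, 1 / 2 < t < 1 -> 0 < sg * even_coef c t) -> 0 < sg * (x 1 - x 0).
Proof.
  intros Hx Hx0 Hsg.
  destruct (asymmetry_scaled c x Hx Hx0) as [z [w [Hz [Hw Hzx]]]].
  destruct (mvt z (fun t => even_coef c t * w t) (1 / 2) 1) as [u [Hu E]]; [lra | intros; apply Hz; lra |].
  destruct (Hzx (1 / 2)) as [m [Hm Em]]; [lra|].
  unfold asymmetry in Em; replace (1 - 1 / 2) with (1 / 2) in Em by field.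
  assert (z (1 / 2) = 0) by (destruct (Rmult_integral m (z (1 / 2))); lra).
  destruct (Hzx 1) as [m1 [Hm1 Em1]]; [lra|].
  unfold asymmetry in Em1; rewrite Rminus_diag in Em1; rewrite Em1.
  replace (z 1) with (even_coef c u * w u * (1 - 1 / 2)) by lra.
  specialize (Hsg u Hu); specialize (Hw u ltac:(lra)).
  replace (sg * (m1 * (even_coef c u * w u * (1 - 1 / 2))))
    with (sg * even_coef c u * (m1 * w u / 2)) by field.
  apply Rmult_lt_0_compat; [assumption|].
  assert (0 < m1 * w u) by (now apply Rmult_lt_0_compat); lra.
Qed.

(* [asymmetry x] vanishes at 1/2 and 1 and, [even_coef c] having at most one zero on (1/2,1),
   nowhere in between; hence [int A x^2 = int_(1/2)^1 A(t) (x(t)^2 - x(1-t)^2) dt] is not zero. *)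
Lemma reversible_periodic_hyperbolic (c : R) (x : R -> R) :
  is_sol odd_coef (even_coef c) x -> x 0 <> 0 -> x 0 = x 1 ->
  hyperbolic odd_coef (even_coef c) (x 0).
Proof.
  intros Hx Hx0 Hper.
  assert (CA := fun (t : R) (_ : 0 <= t <= 1) => odd_coef_continuous t).
  assert (CB := fun (t : R) (_ : 0 <= t <= 1) => even_coef_continuous c t).
  assert (Has : forall t, 1 / 2 < t < 1 -> asymmetry x t <> 0).
  { intros t Ht E.
    destruct (asymmetry_scaled c x Hx Hx0) as [z [w [Hz [Hw Hzx]]]].
    assert (Z : forall s, 0 <= s <= 1 -> asymmetry x s = 0 -> z s = 0).
    { intros s Hs Es; destruct (Hzx s Hs) as [m [Hm Em]].
      destruct (Rmult_integral m (z s)); lra. }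
    assert (Z0 : z (1 / 2) = 0).
    { apply Z; [lra|]; unfold asymmetry; replace (1 - 1 / 2) with (1 / 2) by field; ring. }
    assert (Z1 : z 1 = 0).
    { apply Z; [lra|]; unfold asymmetry; rewrite Rminus_diag; lra. }
    assert (Zt : z t = 0) by (apply Z; [lra | exact E]).
    destruct (rolle z (fun t => even_coef c t * w t) (1 / 2) t) as [u [Hu Eu]];
      [lra | intros; apply Hz; lra | lra |].
    destruct (rolle z (fun t => even_coef c t * w t) t 1) as [v [Hv Ev]];
      [lra | intros; apply Hz; lra | lra |].
    assert (W1 := Hw u ltac:(lra)); assert (W2 := Hw v ltac:(lra)).
    assert (B1 : even_coef c u = 0) by (destruct (Rmult_integral _ _ Eu); lra).
    assert (B2 : even_coef c v = 0) by (destruct (Rmult_integral _ _ Ev); lra).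
    (* [even_coef c] is strictly increasing on (1/2,1), so it cannot vanish at both [u < v]. *)
    unfold even_coef in B1, B2; nra. }
  destruct (primitive_unit (fun t => odd_coef t * x t ^ 2)) as [J HJ].
  { intros t Ht; continuity_tac; try apply continuous_var; exact (is_sol_continuous _ _ x t Hx Ht). }
  apply (hyperbolic_of_multiplier _ _ CA CB x J Hx Hx0 Hper HJ); intros EJ.
  destruct (rolle (fun t => J t - J (1 - t))
    (fun t => odd_coef t * (x t + x (1 - t)) * asymmetry x t) (1 / 2) 1) as [t [Ht E]]; [lra | | |].
  - intros t Ht; assert (D1 := HJ t ltac:(lra)).
    assert (D2 := is_derive_reflect J t _ (HJ (1 - t) ltac:(lra))).
    replace (odd_coef t * (x t + x (1 - t)) * asymmetry x t)
      with (minus (odd_coef t * x t ^ 2) (- (odd_coef (1 - t) * x (1 - t) ^ 2)))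
      by (unfold minus, plus, opp, asymmetry, odd_coef; simpl; field).
    exact (is_derive_minus J (fun s => J (1 - s)) t _ _ D1 D2).
  - replace (1 - 1 / 2) with (1 / 2) by field; rewrite Rminus_diag; rewrite Rminus_diag, EJ; ring.
  - revert E; repeat apply Rmult_integral_contrapositive_currified; [unfold odd_coef; lra | | now apply Has].
    assert (S1 := sol_same_sign _ _ CA CB x t Hx Hx0 ltac:(lra)).
    assert (S2 := sol_same_sign _ _ CA CB x (1 - t) Hx Hx0 ltac:(lra)).
    intros E; assert ((x t + x (1 - t)) * x 0 = 0) by (rewrite E; ring); lra.
Qed.

(** * Existence of a periodic orbit by continuity in the parameter *)

Lemma reversible_cut_bound (c t y : R) :
  0 <= c <= 1 / 4 -> Rabs (abel_cut odd_coef (even_coef c) 1 t y) <= 3 / 4.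
Proof.
  intros Hc; unfold abel_cut.
  assert (T := clamp_bounds 0 1 t ltac:(lra)); set (s := clamp 0 1 t) in *.
  assert (Y := clamp_abs 1 ltac:(lra) y); set (v := clamp (- (1)) 1 y) in *.
  replace (3 / 4) with (1 / 2 * 1 ^ 3 + 1 / 4 * 1 ^ 2) by field.
  apply Rabs_plus_le; apply Rabs_mult_le; try now apply Rabs_pow_le.
  - unfold odd_coef; split_Rabs; lra.
  - assert (0 <= (s - 1 / 2) ^ 2) by apply pow2_ge_0.
    assert (0 <= s * (1 - s)) by (apply Rmult_le_pos; lra).
    unfold even_coef; apply Rabs_le; lra.
Qed.

(** Speed at most 3/4 during a time at most 1/2 keeps the cut solution within 3/8 of 1/2 on [0,1]:
    it stays positive and below 1, where the cut is inactive. *)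
Lemma reversible_orbit (c : R) : 0 <= c <= 1 / 4 ->
  exists x : R -> R, x (1 / 2) = 1 / 2 /\
    (forall t, is_derive x t (abel_cut odd_coef (even_coef c) 1 t (x t))) /\
    is_sol odd_coef (even_coef c) x /\ 0 < x 0.
Proof.
  intros Hc.
  assert (CA := fun (t : R) (_ : 0 <= t <= 1) => odd_coef_continuous t).
  assert (CB := fun (t : R) (_ : 0 <= t <= 1) => even_coef_continuous c t).
  destruct (abel_cut_solution odd_coef (even_coef c) 1 ltac:(lra) CA CB (1 / 2) (1 / 2)) as [x [H0 Hx]].
  assert (Hb : forall t, 0 <= t <= 1 -> Rabs (x t - 1 / 2) <= 3 / 8).
  { intros t Ht.
    destruct (MVT_gen x (1 / 2) t (fun s => abel_cut odd_coef (even_coef c) 1 s (x s))) as [u [_ E]].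
    - intros s _; apply Hx.
    - intros s _; apply continuity_pt_filterlim; exact (is_derive_continuous _ _ _ (Hx s)).
    - rewrite H0 in E; rewrite E.
      replace (3 / 8) with (3 / 4 * (1 / 2)) by field.
      apply Rabs_mult_le; [now apply reversible_cut_bound | split_Rabs; lra]. }
  exists x; split; [exact H0 | split; [exact Hx | split]].
  - intros t Ht; rewrite <- (abel_cut_id _ _ 1 t (x t) Ht); [apply Hx|].
    specialize (Hb t Ht); revert Hb; split_Rabs; lra.
  - specialize (Hb 0 ltac:(lra)); revert Hb; split_Rabs; lra.
Qed.

Lemma reversible_dependence :
  exists L, 0 <= L /\ forall c d x y, 0 <= c <= 1 / 4 -> 0 <= d <= 1 / 4 ->
    x (1 / 2) = 1 / 2 -> (forall t, is_derive x t (abel_cut odd_coef (even_coef c) 1 t (x t))) ->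
    y (1 / 2) = 1 / 2 -> (forall t, is_derive y t (abel_cut odd_coef (even_coef d) 1 t (y t))) ->
    forall t, 0 <= t <= 1 -> Rabs (x t - y t) <= L * Rabs (c - d).
Proof.
  destruct (abel_cut_bounds odd_coef (even_coef 0) 1) as [M [K [HK [_ HL]]]];
    [lra | intros; apply odd_coef_continuous | intros; apply even_coef_continuous |].
  (* The parameter adds at most [1 / 4 * (1 + 1)] to the Lipschitz constant, so [K + 1], with [K]
     taken at parameter 0, serves for all [c] in [0,1/4]. *)
  assert (HL' : forall c t y z, 0 <= c <= 1 / 4 ->
     Rabs (abel_cut odd_coef (even_coef c) 1 t y - abel_cut odd_coef (even_coef c) 1 t z)
     <= (K + 1) * Rabs (y - z)).
  { intros c t y z Hc.
    assert (P := clamp_lipschitz (- (1)) 1 y z).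
    assert (Y := clamp_abs 1 ltac:(lra) y); assert (Z := clamp_abs 1 ltac:(lra) z).
    specialize (HL t y z).
    replace (abel_cut odd_coef (even_coef c) 1 t y - abel_cut odd_coef (even_coef c) 1 t z)
      with (abel_cut odd_coef (even_coef 0) 1 t y - abel_cut odd_coef (even_coef 0) 1 t z +
        c * (clamp (- (1)) 1 y + clamp (- (1)) 1 z) * (clamp (- (1)) 1 y - clamp (- (1)) 1 z))
      by (unfold abel_cut, even_coef; ring).
    rewrite Rmult_plus_distr_r; apply Rabs_plus_le; [exact HL|].
    apply Rabs_mult_le; [|exact P].
    apply Rle_trans with (1 / 4 * (1 + 1)); [|lra].
    apply Rabs_mult_le; [split_Rabs; lra | now apply Rabs_plus_le]. }
  (* Gronwall is applied to [(x - y)^2 + e^2] with [e = c - d]: the added constant makes the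
     inequality homogeneous, and [2 |x - y| |e| <= (x - y)^2 + e^2] accounts for the final 1. *)
  set (N := 2 * (K + 1) + 1).
  exists (exp (N / 2)); split; [left; apply exp_pos|].
  intros c d x y Hc Hd Hx0 Hx Hy0 Hy t Ht.
  rewrite Rmult_comm; apply abs_le_sqrt_exp; [apply Rabs_pos|].
  set (e := c - d); rewrite pow2_abs.
  assert (G := gronwall_two_sided (fun s => (x s - y s) ^ 2 + e ^ 2)
    (fun s => 2 * (x s - y s) * (abel_cut odd_coef (even_coef c) 1 s (x s) -
                                 abel_cut odd_coef (even_coef d) 1 s (y s))) N (1 / 2) t).
  cbv beta in G; rewrite Hx0, Hy0, Rminus_diag in G.
  apply Rle_trans with (0 ^ 2 + e ^ 2 + - e ^ 2 + e ^ 2 * exp (N * Rabs (t - 1 / 2))).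
  { assert (0 <= e ^ 2) by apply pow2_ge_0.
    apply Rle_trans with ((x t - y t) ^ 2 + e ^ 2); [lra|].
    replace (0 ^ 2 + e ^ 2 + - e ^ 2 + e ^ 2 * exp (N * Rabs (t - 1 / 2)))
      with ((0 ^ 2 + e ^ 2) * exp (N * Rabs (t - 1 / 2))) by ring.
    apply G; intros s _.
    - assert (D1 := Hx s); assert (D2 := Hy s).
      auto_derive; [repeat split; eexists; eassumption|].
      rewrite_derive D1; rewrite_derive D2; ring.
    - replace (abel_cut odd_coef (even_coef c) 1 s (x s) - abel_cut odd_coef (even_coef d) 1 s (y s))
        with (abel_cut odd_coef (even_coef c) 1 s (x s) - abel_cut odd_coef (even_coef c) 1 s (y s)
              + e * clamp (- (1)) 1 (y s) ^ 2) by (unfold abel_cut, even_coef, e; ring).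
      apply Rle_trans with (2 * Rabs (x s - y s) * ((K + 1) * Rabs (x s - y s) + Rabs e * 1 ^ 2)).
      + rewrite !Rabs_mult, (Rabs_pos_eq 2) by lra.
        apply Rmult_le_compat_l; [pose proof (Rabs_pos (x s - y s)); lra|].
        apply Rabs_plus_le; [now apply HL'|].
        apply Rabs_mult_le; [apply Rle_refl | apply Rabs_pow_le, clamp_abs; lra].
      + rewrite <- (pow2_abs (x s - y s)), <- (pow2_abs e); unfold N.
        assert (0 <= (Rabs (x s - y s) - Rabs e) ^ 2) by apply pow2_ge_0.
        assert (0 <= Rabs e ^ 2) by apply pow2_ge_0. nra. }
  rewrite pow_i by lia; rewrite Rplus_0_l, Rplus_opp_r, Rplus_0_l.
  apply Rmult_le_compat_l; [apply pow2_ge_0|].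
  assert (Rabs (t - 1 / 2) <= 1 / 2) by (split_Rabs; lra).
  destruct (Req_dec (Rabs (t - 1 / 2)) 1) as [E1 | Hn]; [lra|].
  apply Rlt_le, exp_increasing; unfold N; nra.
Qed.

(** Intermediate values in the parameter: on (1/2,1) [even_coef c] is negative for [c = 0] and
    positive for [c = 1 / 4], and [asymmetry_sign] transfers this to [x 1 - x 0]. *)
Lemma reversible_periodic_orbit : exists c x,
  is_sol odd_coef (even_coef c) x /\ 0 < x 0 /\ x 0 = x 1.
Proof.
  (* Clamping the parameter makes the displacement a continuous function on the whole line, as [IVT]
     requires. *)
  assert (cb : forall c, 0 <= clamp 0 (1 / 4) c <= 1 / 4) by (intros; apply clamp_bounds; lra).
  set (X := fun c => proj1_sig (constructive_indefinite_description _ (reversible_orbit _ (cb c)))).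
  assert (HX : forall c, X c (1 / 2) = 1 / 2 /\
    (forall t, is_derive (X c) t (abel_cut odd_coef (even_coef (clamp 0 (1 / 4) c)) 1 t (X c t))) /\
    is_sol odd_coef (even_coef (clamp 0 (1 / 4) c)) (X c) /\ 0 < X c 0)
    by (intros c; exact (proj2_sig (constructive_indefinite_description _ (reversible_orbit _ (cb c))))).
  clearbody X.
  destruct reversible_dependence as [L [HL dep]].
  assert (Hcont : continuity (fun c => X c 1 - X c 0)).
  { intros c; apply continuity_pt_filterlim.
    apply (continuous_lipschitz (fun c => X c 1 - X c 0) (2 * L)); intros d.
    destruct (HX c) as [H1 [H2 _]]; destruct (HX d) as [H3 [H4 _]].
    assert (D := dep _ _ _ _ (cb d) (cb c) H3 H4 H1 H2).
    assert (D0 := D 0 ltac:(lra)); assert (D1 := D 1 ltac:(lra)).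
    assert (P := clamp_lipschitz 0 (1 / 4) d c).
    apply Rmult_le_compat_l with (r := L) in P; [|exact HL].
    revert D0 D1; split_Rabs; lra. }
  destruct (IVT (fun c => X c 1 - X c 0) 0 (1 / 4) Hcont) as [c [Hc Ec]]; [lra | | |].
  - destruct (HX 0) as [_ [_ [Hs Hp]]]; rewrite clamp_id in Hs by lra.
    assert (0 < -1 * (X 0 1 - X 0 0)); [|lra].
    apply (asymmetry_sign 0 (-1) _ Hs); [lra|]; intros t Ht; unfold even_coef; nra.
  - destruct (HX (1 / 4)) as [_ [_ [Hs Hp]]]; rewrite clamp_id in Hs by lra.
    assert (0 < 1 * (X (1 / 4) 1 - X (1 / 4) 0)); [|lra].
    apply (asymmetry_sign (1 / 4) 1 _ Hs); [lra|]; intros t Ht; unfold even_coef; nra.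
  - destruct (HX c) as [_ [_ [Hs Hp]]]; rewrite clamp_id in Hs by lra.
    exists c, (X c); split; [exact Hs | split; [exact Hp | lra]].
Qed.

Lemma two_hyperbolic_orbits :
  exists (j k : nat) (a0 a1 a2 b0 b1 b2 : R),
     (0 < j < k)%nat /\
     exists x0 y0, x0 <> 0 /\ y0 <> 0 /\ x0 <> y0 /\
       hyperbolic (trinom a0 a1 a2 j k) (trinom b0 b1 b2 j k) x0 /\
       hyperbolic (trinom a0 a1 a2 j k) (trinom b0 b1 b2 j k) y0.
Proof.
  destruct reversible_periodic_orbit as [c [x [Hx [Hx0 Hper]]]].
  exists 1%nat, 2%nat, (- (1 / 2)), 1, 0, c, (-1), 1.
  replace (trinom (- (1 / 2)) 1 0 1 2) with odd_coef
    by (apply functional_extensionality; intros t; unfold trinom, odd_coef; ring).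
  replace (trinom c (-1) 1 1 2) with (even_coef c)
    by (apply functional_extensionality; intros t; unfold trinom, even_coef; ring).
  split; [lia|].
  (* The reversed solution starts at [- x 1 = - x 0], of sign opposite to [x 0]. *)
  exists (x 0), (- x (1 - 0)); rewrite Rminus_0_r.
  repeat split; try lra.
  1-3: apply (reversible_periodic_hyperbolic c x Hx); lra.
  all: assert (H := reversible_periodic_hyperbolic c _ (is_sol_reverse c x Hx)); cbv beta in H;
    rewrite Rminus_0_r, Rminus_diag in H; apply H; lra.
Qed.

Theorem theoremC :
  (* (a) center characterization *)
  (forall (j k : nat) (a0 a1 a2 b0 b1 b2 : R),
     (0 < j < k)%nat ->
     (has_center_at_0 (trinom a0 a1 a2 j k) (trinom b0 b1 b2 j k) <->
      (a0 + a1 / INR (j + 1) + a2 / INR (k + 1) = 0 /\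
       b0 + b1 / INR (j + 1) + b2 / INR (k + 1) = 0 /\
       a2 * b1 - a1 * b2 = 0))) /\
  (* (b) at most one non-zero periodic orbit, hyperbolic *)
  (forall (j k : nat) (a0 a1 a2 b0 b1 b2 : R),
     (0 < j < k)%nat ->
     ~ has_center_at_0 (trinom a0 a1 a2 j k) (trinom b0 b1 b2 j k) ->
     (cond_ratio (a2 * b0 - a0 * b2) (a2 * b1 - a1 * b2) \/
      cond_ratio (a1 * b0 - a0 * b1) (a1 * b2 - a2 * b1) \/
      cond_ratio (a0 * b1 - a1 * b0) (a0 * b2 - a2 * b0)) ->
     (forall x0 y0, x0 <> 0 -> y0 <> 0 ->
        periodic_orbit (trinom a0 a1 a2 j k) (trinom b0 b1 b2 j k) x0 ->
        periodic_orbit (trinom a0 a1 a2 j k) (trinom b0 b1 b2 j k) y0 ->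
        x0 = y0) /\
     (forall x0, x0 <> 0 ->
        periodic_orbit (trinom a0 a1 a2 j k) (trinom b0 b1 b2 j k) x0 ->
        hyperbolic (trinom a0 a1 a2 j k) (trinom b0 b1 b2 j k) x0)) /\
  (* (c) existence of two non-zero hyperbolic periodic orbits *)
  (exists (j k : nat) (a0 a1 a2 b0 b1 b2 : R),
     (0 < j < k)%nat /\
     exists x0 y0, x0 <> 0 /\ y0 <> 0 /\ x0 <> y0 /\
       hyperbolic (trinom a0 a1 a2 j k) (trinom b0 b1 b2 j k) x0 /\
       hyperbolic (trinom a0 a1 a2 j k) (trinom b0 b1 b2 j k) y0).
Proof.
  split; [exact center_iff | split; [exact trinomial_orbits_unique | exact two_hyperbolic_orbits]].
Qed.
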